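(* Let $(M^3,g)$ be an oriented $3$-dimensional Riemannian manifold and let $\xi$ be a (global, smooth) unit vector field on $M$. Let $\eta=g(\xi,\cdot)$, and let $(\varphi,\xi,\eta,g)$ be the almost contact metric structure determined by $\xi$ and the orientation, i.e. $\varphi\xi=0$ and $\varphi X=\xi\times X$ for $X\in\xi^\perp$. Then the following are equivalent: (a) $(\varphi,\xi,\eta,g)$ is trans-Sasakian of type $(\alpha,\beta)$ for some smooth functions $\alpha,\beta$ on $M$; (b) the congruence generated by $\xi$ is geodesic and shear-free; (c) the foliation generated by $\xi$ is a conformal foliation by geodesics. When these conditions hold, $$\nabla_X\xi=-\alpha\varphi X+\beta\bigl(X-\eta(X)\xi\bigr)$$ for every vector field $X$, and $\beta=\Theta$, $\alpha=\omega$, where $\Theta$ and $\omega$ are the expansion and twist of $\xi$.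
   Context: $\nabla$ is the Levi-Civita connection of $g$ and $\times$ is the cross product determined by $g$ and the orientation; thus for a local oriented orthonormal frame $(e_1,e_2,\xi)$ one has $\varphi e_1=e_2$, $\varphi e_2=-e_1$, $\varphi\xi=0$. The structure is trans-Sasakian of type $(\alpha,\beta)$ if for all vector fields $X,Y$ $$(\nabla_X\varphi)Y=\alpha\{g(X,Y)\xi-\eta(Y)X\}+\beta\{g(\varphi X,Y)\xi-\eta(Y)\varphi X\}.$$ Put $\mathcal{D}=\xi^\perp=\ker\eta$ and $A:\mathcal{D}\to\mathcal{D}$, $A(X)=\nabla_X\xi$. In a local oriented orthonormal frame $(e_1,e_2,\xi)$ write $\nabla_{e_1}\xi=f_{11}e_1+f_{12}e_2$ and $\nabla_{e_2}\xi=f_{21}e_1+f_{22}e_2$. The expansion is $\Theta=\frac12\operatorname{tr}A=\frac12(f_{11}+f_{22})$, the twist is $\omega=\frac12(f_{21}-f_{12})$, and the shear is the trace-free symmetric part of $A$. The congruence (family of integral curves) generated by $\xi$ is geodesic if $\nabla_\xi\xi=0$, and shear-free if the shear vanishes, i.e. $f_{11}=f_{22}$ and $f_{12}+f_{21}=0$. The one-dimensional foliation generated by $\xi$ is conformal if there is a smooth function $\lambda$ with $(\mathcal{L}_\xi g)(X,Y)=2\lambda g(X,Y)$ for all $X,Y\in\mathcal{D}$, where $\mathcal{L}$ is the Lie derivative; it is a conformal foliation by geodesics if in addition its leaves are geodesics (i.e. $\nabla_\xi\xi=0$). *)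

(* Defs.v *)
From mathcomp Require Import all_boot all_order all_algebra.
From mathcomp Require Import all_classical all_reals all_analysis.

Set Implicit Arguments.
Unset Strict Implicit.
Unset Printing Implicit Defensive.

Import Order.TTheory GRing.Theory Num.Theory.
Import numFieldNormedType.Exports.

Local Open Scope classical_set_scope.
Local Open Scope ring_scope.

(* Conventions. A 3-manifold is given by an atlas [chart i], [i : chart_index],
   with values in 'rV[R]_3. A tangent vector at p is the family of its
   components [v i : 'rV_3] in the charts around p, subject to the usual
   transformation law; vectors are rows, so linear maps act on the right.
   Every field on M is thus indexed by a chart i and a point p, and its value
   is meaningful only when p lies in [chart_dom i]. *)

Section Smooth.
Context {R : realType} {W : normedModType R}.

Fixpoint Ck_on (n k : nat) (U : set 'rV[R]_n) (f : 'rV[R]_n -> W) : Prop :=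
  if k is k'.+1 then
    (forall x, U x -> differentiable f x) /\
    (forall a : 'I_n, Ck_on k' U (fun x => 'D_(delta_mx 0 a) f x))
  else forall x, U x -> {for x, continuous f}.

(* C^infinity on an open set U *)
Definition smooth_on (n : nat) (U : set 'rV[R]_n) (f : 'rV[R]_n -> W) : Prop :=
  forall k, Ck_on k U f.

End Smooth.

(* Smooth 3-manifolds with an orientation, the latter given by the requirement
   that all the charts of the atlas are positively oriented. *)
Record oriented_3manifold (R : realType) := Oriented3Manifold {
  carrier :> topologicalType;
  chart_index : Type;
  chart_dom : chart_index -> set carrier;
  chart : chart_index -> carrier -> 'rV[R]_3;
  chart_inv : chart_index -> 'rV[R]_3 -> carrier;
  manifold_hausdorff : hausdorff_space carrier;
  manifold_second_countable : @second_countable carrier;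
  chart_cover : forall p, exists i, chart_dom i p;
  chart_dom_open : forall i, open (chart_dom i);
  chart_im_open : forall i, open (chart i @` chart_dom i);
  chartK : forall i p, chart_dom i p -> chart_inv i (chart i p) = p;
  chart_continuous :
    forall i p, chart_dom i p -> {for p, continuous (chart i)};
  chart_inv_continuous : forall i x, (chart i @` chart_dom i) x ->
    {for x, continuous (chart_inv i)};
  transition_smooth : forall i j,
    smooth_on (chart i @` (chart_dom i `&` chart_dom j))
      (chart j \o chart_inv i);
  transition_oriented : forall i j p, chart_dom i p -> chart_dom j p ->
    0 < \det ('J (chart j \o chart_inv i) (chart i p))
}.

Section Fields.
Context {R : realType} {M : oriented_3manifold R}.
Implicit Types (i j : chart_index M) (p : M) (U : set M).

Definition transition_jacobian i j p : 'M[R]_3 :=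
  'J (chart j \o chart_inv i) (chart i p).

Definition smooth_fun (f : M -> R) : Prop :=
  forall i, @smooth_on R R^o 3 (chart i @` chart_dom i) (f \o chart_inv i).

Definition tangent_field : Type := chart_index M -> M -> 'rV[R]_3.
Definition scalar_field : Type := chart_index M -> M -> R.

Definition smooth_field_on U (X : tangent_field) : Prop :=
  (forall i j p, U p -> chart_dom i p -> chart_dom j p ->
     X j p = X i p *m transition_jacobian i j p) /\
  (forall i, smooth_on (chart i @` (U `&` chart_dom i)) (X i \o chart_inv i)).

Definition vector_field (X : tangent_field) : Prop := smooth_field_on setT X.

(* X(f) *)
Definition deriv_along (X : tangent_field) (f : scalar_field) : scalar_field := fun i p =>
  'D_(X i p) (f i \o chart_inv i : 'rV[R]_3 -> R^o) (chart i p).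

(* [X, Y] *)
Definition bracket (X Y : tangent_field) : tangent_field := fun i p =>
  'D_(X i p) (Y i \o chart_inv i) (chart i p)
  - 'D_(Y i p) (X i \o chart_inv i) (chart i p).

End Fields.
Arguments tangent_field {R} M.
Arguments scalar_field {R} M.

Record riemannian_metric (R : realType) (M : oriented_3manifold R) :=
  RiemannianMetric {
  metric_mx : chart_index M -> M -> 'M[R]_3;
  metric_sym : forall i p, chart_dom i p -> (metric_mx i p)^T = metric_mx i p;
  metric_pos : forall i p (v : 'rV[R]_3), chart_dom i p -> v != 0 ->
    0 < (v *m metric_mx i p *m v^T) 0 0;
  metric_transition : forall i j p, chart_dom i p -> chart_dom j p ->
    metric_mx i p =
      transition_jacobian i j p *m metric_mx j p *m (transition_jacobian i j p)^T;
  metric_smooth : forall i,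
    smooth_on (chart i @` chart_dom i) (metric_mx i \o chart_inv i)
}.

Section Geometry.
Context {R : realType} {M : oriented_3manifold R} (g : riemannian_metric M).
Implicit Types (X Y Z xi : tangent_field M) (i : chart_index M) (p : M).
Implicit Types (e : 'I_2 -> tangent_field M).

Definition dot X Y : scalar_field M := fun i p =>
  (X i p *m metric_mx g i p *m (Y i p)^T) 0 0.

(* partial derivative of g_{bc} in the direction of the a-th coordinate *)
Definition dmetric i p (a b c : 'I_3) : R :=
  'D_(delta_mx 0 a) ((fun x => metric_mx g i (chart_inv i x) b c)
                     : 'rV[R]_3 -> R^o) (chart i p).

(* Gamma^c_{ab} *)
Definition christoffel i p (a b c : 'I_3) : R :=
  2^-1 * \sum_d invmx (metric_mx g i p) c d *
    (dmetric i p a b d + dmetric i p b a d - dmetric i p d a b).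

(* Levi-Civita connection, nabla_X Y *)
Definition nabla X Y : tangent_field M := fun i p =>
  'D_(X i p) (Y i \o chart_inv i) (chart i p)
  + \row_c \sum_a \sum_b X i p 0 a * Y i p 0 b * christoffel i p a b c.

Definition rows3 (u v w : 'rV[R]_3) : 'M[R]_3 :=
  \matrix_(k < 3) [:: u; v; w]`_k.

Definition volume i p (u v w : 'rV[R]_3) : R :=
  Num.sqrt (\det (metric_mx g i p)) * \det (rows3 u v w).

(* The vector field such that g(X x Y, Z) = volume(X, Y, Z) for all Z. *)
Definition cross X Y : tangent_field M := fun i p =>
  (\row_k volume i p (X i p) (Y i p) (delta_mx 0 k))
    *m invmx (metric_mx g i p).

Definition unit_field xi : Prop :=
  forall i p, chart_dom i p -> dot xi xi i p = 1.

Definition eta xi X : scalar_field M := dot xi X.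

(* X - eta(X) xi *)
Definition horizontal xi X : tangent_field M := fun i p =>
  X i p - eta xi X i p *: xi i p.

(* The endomorphism that kills xi and is X |-> xi x X on xi^perp. *)
Definition phi xi X : tangent_field M := cross xi (horizontal xi X).

Definition trans_sasakian xi (alpha beta : M -> R) : Prop :=
  forall X Y, vector_field X -> vector_field Y ->
  forall i p, chart_dom i p ->
    nabla X (phi xi Y) i p - phi xi (nabla X Y) i p =
      alpha p *: (dot X Y i p *: xi i p - eta xi Y i p *: X i p)
      + beta p *: (dot (phi xi X) Y i p *: xi i p
                   - eta xi Y i p *: phi xi X i p).

(* (e 0, e 1, xi) is an oriented orthonormal frame on the open set U. *)
Definition oriented_frame xi (U : set M) e : Prop :=
  [/\ open U,
      forall a, smooth_field_on U (e a) &
      forall i p, U p -> chart_dom i p ->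
        [/\ forall a b, dot (e a) (e b) i p = (a == b)%:R,
            forall a, dot (e a) xi i p = 0 &
            0 < \det (rows3 (e 0 i p) (e 1 i p) (xi i p))]].

(* The matrix (f_ab) of A = nabla xi on xi^perp:
   nabla_{e_a} xi = f_a0 e_0 + f_a1 e_1 for a frame (e_0, e_1, xi), the
   coefficient on xi being zero because xi is a unit field. *)
Definition nabla_mx xi e i p : 'M[R]_2 :=
  \matrix_(a, b) dot (nabla (e a) xi) (e b) i p.

Definition expansion xi e : scalar_field M := fun i p =>
  2^-1 * \tr (nabla_mx xi e i p).

Definition twist xi e : scalar_field M := fun i p =>
  2^-1 * (nabla_mx xi e i p 1 0 - nabla_mx xi e i p 0 1).

Definition shear xi e i p : 'M[R]_2 :=
  2^-1 *: (nabla_mx xi e i p + (nabla_mx xi e i p)^T)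
  - (expansion xi e i p)%:M.

Definition geodesic xi : Prop :=
  forall i p, chart_dom i p -> nabla xi xi i p = 0.

Definition shear_free xi : Prop :=
  forall U e, oriented_frame xi U e ->
  forall i p, U p -> chart_dom i p -> shear xi e i p = 0.

(* (L_Z g)(X, Y) *)
Definition lie_metric Z X Y : scalar_field M := fun i p =>
  deriv_along Z (dot X Y) i p
  - dot (bracket Z X) Y i p - dot X (bracket Z Y) i p.

(* X is a smooth section of the distribution xi^perp. *)
Definition section_perp xi X : Prop :=
  vector_field X /\ forall i p, chart_dom i p -> eta xi X i p = 0.

Definition conformal_foliation xi : Prop :=
  exists2 lambda : M -> R, smooth_fun lambda &
  forall X Y, section_perp xi X -> section_perp xi Y ->
  forall i p, chart_dom i p ->
    lie_metric xi X Y i p = 2 * lambda p * dot X Y i p.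

End Geometry.

(* Main.v *)
(* Let A = nabla xi. Since xi is a unit field, A takes values in xi^perp, and since
   nabla preserves the metric and the volume form, (nabla_X phi) Y = (A X) x Y.
   In an oriented orthonormal frame (e_1, e_2, xi), "geodesic and shear-free" says
   that A kills xi and acts on xi^perp as a multiple of the identity plus a multiple
   of the rotation phi, that is A = - alpha phi + beta (1 - eta xi); vector identities
   for the cross product then give the trans-Sasakian equation. Conversely, the
   trans-Sasakian equation with Y = xi reads - phi (A X) = alpha (eta(X) xi - X)
   - beta phi X, and applying phi recovers A. Conformality follows from
   (L_xi g)(X, Y) = g(A X, Y) + g(X, A Y).

   The hypotheses quantify over global fields whereas the conclusions are pointwise:
   tangent vectors are extended to global fields with a bump function. The scalars
   alpha and beta are recovered as traces, which do not depend on the chart because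
   the Christoffel symbols obey the transformation law of a connection; that law is
   deduced from the uniqueness of torsion-free metric connections and from the
   symmetry of second derivatives. *)
Require Import Defs.
From mathcomp Require Import all_boot all_order all_algebra.
From mathcomp Require Import all_classical all_reals all_analysis.
From mathcomp Require Import ring lra.
Import Order.TTheory GRing.Theory Num.Theory.
Import numFieldNormedType.Exports.
Local Open Scope classical_set_scope.
Local Open Scope ring_scope.
Set Implicit Arguments.
Unset Strict Implicit.
Unset Printing Implicit Defensive.

(** * Smooth functions *)

Section Calculus.
Context {R : realType}.

(** At one point of one chart the geometry becomes algebra of 3 by 3 matrices: the data are the Gram
    matrix [G] of the metric, the row of xi, and the matrix [N] of v |-> nabla_v xi ([nabla_op]).
    Each of the three conditions is compared with one statement about these data, [rotation_form].
    The difficulties lie in what surrounds this algebra. Shear-freeness is tested on local frames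
    only, so it says nothing at a point until a frame has been built there, while xi^perp may have
    no global frame. Fields and matrices are families indexed by charts, so every construction needs
    a transformation law besides smoothness in each chart. Checking the law of the Christoffel
    symbols from their formula would mix derivatives of the metric, inverse matrices and second
    derivatives of the transition map. The uniqueness argument replaces this by two checks on the
    pulled-back connection, and second derivatives enter only through the identity
    [u *m 'D_v J = v *m 'D_u J] for the Jacobian [J] of the transition map. *)

Lemma near_eq_differentiable (V W : normedModType R) (f g : V -> W) (x : V) :
  {near x, f =1 g} -> differentiable f x -> differentiable g x.
Proof.
move=> fg df; rewrite (_ : g = f + (g - f)); last by rewrite addrC subrK.
apply: differentiableD => //; set h := g - f.
have h0 : \forall y \near x, h y = 0.
  by apply: filterS fg => y fgy; rewrite /h !fctE fgy subrr.
have h0' : \forall y \near (0 : V), h (y + x) = 0.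
  by move: h0; rewrite [\forall y \near _, _](near_shift 0) subr0.
(* A map vanishing near [x] is negligible against the increment, so its differential at [x] is
   zero. *)
have hE : h \o shift x = cst (h x) + (\0 : V -> W) +o_ 0 id.
  apply/eqaddoP => _/posnumP[e]; apply: filterS h0' => y hy.
  by rewrite /= !fctE /= (nbhs_singleton h0) hy addr0 subr0 normr0 mulr_ge0.
have d0 : continuous (\0 : V -> W) by move=> y; exact: cst_continuous.
have dh := diff_unique d0 hE.
by apply/diff_locallyP; rewrite dh.
Qed.

Lemma derive_comp (U V W : normedModType R) (f : U -> V) (g : V -> W) x v :
  differentiable f x -> differentiable g (f x) ->
  'D_v (g \o f) x = 'D_('D_v f x) g (f x).
Proof.
move=> df dg; rewrite deriveE; last exact: differentiable_comp.
by rewrite diff_comp //= -!deriveE.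
Qed.

Lemma derive_rowE (W : normedModType R) n (f : 'rV[R]_n -> W) x v :
  differentiable f x -> 'D_v f x = \sum_a v 0 a *: 'D_(delta_mx 0 a) f x.
Proof.
move=> df; rewrite deriveE // {1}(row_sum_delta v) linear_sum /=.
by apply: eq_bigr => a _; rewrite linearZ -deriveE.
Qed.

Section Ck.
Context {W : normedModType R}.
Implicit Types (n k : nat).

Lemma Ck_on_sub n k (U V : set 'rV[R]_n) (f : 'rV[R]_n -> W) :
  V `<=` U -> Ck_on k U f -> Ck_on k V f.
Proof.
elim: k f => [|k IH] f VU /= ; first by move=> H x /VU /H.
by case=> H1 H2; split=> [x /VU /H1 //|a]; apply: IH.
Qed.

(** Every clause of [Ck_on] concerns derivatives of a function defined on the whole space, evaluated
    at points of [U]. Being C^k is thus a conjunction over points, and smoothness may be checked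
    around each point separately. *)
Lemma Ck_on_point n k (U : set 'rV[R]_n) (f : 'rV[R]_n -> W) :
  (forall x, U x -> Ck_on k [set x] f) -> Ck_on k U f.
Proof.
elim: k f => [|k IH] f H /=; first by move=> x /H; apply.
split=> [x /H [+ _]|a]; first exact.
by apply: IH => x /H [_]; apply.
Qed.

Lemma Ck_onS n k (U : set 'rV[R]_n) (f : 'rV[R]_n -> W) : Ck_on k.+1 U f ->
  (forall x, U x -> differentiable f x) /\
  (forall a, Ck_on k U ('D_(delta_mx 0 a) f)).
Proof. by []. Qed.

Lemma Ck_onW n k (U : set 'rV[R]_n) (f : 'rV[R]_n -> W) :
  Ck_on k.+1 U f -> Ck_on k U f.
Proof.
elim: k f => [|k IH] f.
  by case=> H _ x /H; exact: differentiable_continuous.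
by case=> H1 H2; split=> // a; apply: IH.
Qed.

(** Openness turns equality on [U] into equality near each of its points, so that all derivatives
    agree as well. *)
Lemma Ck_on_eq n k (U : set 'rV[R]_n) (f g : 'rV[R]_n -> W) :
  open U -> (forall x, U x -> f x = g x) -> Ck_on k U f -> Ck_on k U g.
Proof.
move=> oU; elim: k f g => [|k IH] f g fg.
  move=> H x Ux; have fgn : {near x, f =1 g}.
    by apply: filterS (open_nbhs_nbhs (conj oU Ux)) => y /fg.
  rewrite /prop_for /continuous_at -(fg x Ux).
  by apply: cvg_trans (H x Ux); apply: (near_eq_cvg (F := nbhs x)); apply: filterS fgn.
have fgn x : U x -> {near x, f =1 g}.
  by move=> Ux; apply: filterS (open_nbhs_nbhs (conj oU Ux)) => y /fg.
case=> H1 H2; split=> [x Ux|a].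
  by apply: near_eq_differentiable (H1 _ Ux); exact: fgn.
by apply: IH (H2 a) => x Ux; apply: near_eq_derive; exact: fgn.
Qed.

(** Common scheme of the closure properties that follow: a formula [F] for the partial derivatives
    on [U] is supplied, and [F] is C^k by induction because it is built from the given functions and
    their first derivatives. *)
Lemma Ck_onS_intro n k (U : set 'rV[R]_n) (f : 'rV[R]_n -> W) F :
  open U -> (forall x, U x -> differentiable f x) ->
  (forall a x, U x -> 'D_(delta_mx 0 a) f x = F a x) ->
  (forall a, Ck_on k U (F a)) -> Ck_on k.+1 U f.
Proof.
move=> oU df fF HF; split=> // a.
by apply: Ck_on_eq (HF a) => // x Ux; rewrite fF.
Qed.

Lemma smooth_on_sub n (U V : set 'rV[R]_n) (f : 'rV[R]_n -> W) :
  V `<=` U -> smooth_on U f -> smooth_on V f.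
Proof. by move=> VU H k; apply: Ck_on_sub (H k). Qed.

Lemma smooth_on_eq n (U : set 'rV[R]_n) (f g : 'rV[R]_n -> W) :
  open U -> (forall x, U x -> f x = g x) -> smooth_on U f -> smooth_on U g.
Proof. by move=> oU fg H k; apply: Ck_on_eq (H k). Qed.

Lemma smooth_on_local n (U : set 'rV[R]_n) (f : 'rV[R]_n -> W) :
  (forall x, U x -> exists2 V, V x & smooth_on V f) -> smooth_on U f.
Proof.
move=> H k; apply: Ck_on_point => x /H[V Vx fV].
by apply: Ck_on_sub (fV k) => _ ->.
Qed.

Lemma smooth_differentiable n (U : set 'rV[R]_n) (f : 'rV[R]_n -> W) x :
  smooth_on U f -> U x -> differentiable f x.
Proof. by move=> /(_ 1)[+ _]; apply. Qed.

Lemma smooth_on_derive n (U : set 'rV[R]_n) (f : 'rV[R]_n -> W) a :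
  smooth_on U f -> smooth_on U ('D_(delta_mx 0 a) f).
Proof. by move=> H k; have [_] := H k.+1; apply. Qed.

Lemma Ck_on_cst n k (U : set 'rV[R]_n) (c : W) : open U -> Ck_on k U (fun=> c).
Proof.
move=> oU; elim: k c => [|k IH] c; first by move=> x _; exact: cst_continuous.
apply: (@Ck_onS_intro n k U _ (fun=> cst 0)) => // [a x _|a].
  by rewrite derive_cst.
exact: IH.
Qed.

Lemma Ck_onD n k (U : set 'rV[R]_n) (f g : 'rV[R]_n -> W) : open U ->
  Ck_on k U f -> Ck_on k U g -> Ck_on k U (fun x => f x + g x).
Proof.
move=> oU; elim: k f g => [|k IH] f g.
  by move=> Hf Hg x Ux; apply: continuousD; [exact: Hf|exact: Hg].
move=> /Ck_onS[df Hf] /Ck_onS[dg Hg].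
apply: (@Ck_onS_intro n k U _
  (fun a x => 'D_(delta_mx 0 a) f x + 'D_(delta_mx 0 a) g x)) => //.
- by move=> x Ux; apply: differentiableD; [exact: df|exact: dg].
- by move=> a x Ux; rewrite deriveD //; apply: diff_derivable;
    [exact: df|exact: dg].
- by move=> a; exact: IH (Hf a) (Hg a).
Qed.

End Ck.

Lemma Ck_onM n k (U : set 'rV[R]_n) (f g : 'rV[R]_n -> R^o) : open U ->
  Ck_on k U f -> Ck_on k U g -> Ck_on k U (fun x => f x * g x : R^o).
Proof.
move=> oU; elim: k f g => [|k IH] f g.
  by move=> Hf Hg x Ux; apply: continuousM; [exact: Hf|exact: Hg].
move=> Hf' Hg'; have [df Hf] := Ck_onS Hf'; have [dg Hg] := Ck_onS Hg'.
apply: (@Ck_onS_intro R^o n k U _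
  (fun a x => f x * 'D_(delta_mx 0 a) g x + g x * 'D_(delta_mx 0 a) f x)) => //.
- by move=> x Ux; apply: differentiableM; [exact: df|exact: dg].
- by move=> a x Ux; rewrite deriveM //; apply: diff_derivable;
    [exact: df|exact: dg].
- move=> a; apply: Ck_onD => //.
    exact: IH (Ck_onW Hf') (Hg a).
  exact: IH (Ck_onW Hg') (Hf a).
Qed.

Lemma Ck_on_inv n k (U : set 'rV[R]_n) (f : 'rV[R]_n -> R^o) : open U ->
  (forall x, U x -> f x != 0) ->
  Ck_on k U f -> Ck_on k U (fun x => (f x)^-1 : R^o).
Proof.
move=> oU f0; elim: k => [|k IH].
  by move=> Hf x Ux; apply: continuousV; [exact: f0|exact: Hf].
move=> Hf'; have [df Hf] := Ck_onS Hf'.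
have Hi := IH (Ck_onW Hf').
apply: (@Ck_onS_intro R^o n k U _
  (fun a x => (-1) * ((f x)^-1 * (f x)^-1) * 'D_(delta_mx 0 a) f x)) => //.
- by move=> x Ux; apply: differentiableV; [exact: df|exact: f0].
- move=> a x Ux; rewrite deriveV; [|exact: f0|exact/diff_derivable/df].
  by rewrite /GRing.scale /= expr2 invfM mulN1r.
- move=> a; apply: Ck_onM (Hf a) => //.
  by apply: Ck_onM; [|exact: Ck_on_cst|exact: Ck_onM].
Qed.

End Calculus.

Section Calculus2.
Context {R : realType}.

Lemma derive_comp1 (V : normedModType R) (f : V -> R^o) (h : R^o -> R^o) dh x :
  differentiable f x -> is_derive (f x) 1 h dh ->
  differentiable (h \o f : V -> R^o) x /\
  forall v, 'D_v (h \o f : V -> R^o) x = dh * 'D_v f x.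
Proof.
move=> df [hf hE]; have dhf : differentiable h (f x) by apply/derivable1_diffP.
split=> [|v]; first exact: differentiable_comp.
rewrite derive_comp // -hE (deriveE _ dhf) (deriveE _ dhf).
by rewrite -{1}['D_v f x]mulr1 [LHS]linearZ mulrC.
Qed.

Lemma Ck_on_sqrt n k (U : set 'rV[R]_n) (f : 'rV[R]_n -> R^o) : open U ->
  (forall x, U x -> 0 < f x) ->
  Ck_on k U f -> Ck_on k U (fun x => Num.sqrt (f x) : R^o).
Proof.
move=> oU f0; elim: k => [|k IH].
  by move=> Hf x Ux; apply: continuous_comp (Hf x Ux) _; exact: sqrt_continuous.
move=> Hf'; have [df Hf] := Ck_onS Hf'.
have Hi := IH (Ck_onW Hf').
have H x (Ux : U x) := derive_comp1 (df x Ux) (is_derive1_sqrt (f0 x Ux)).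
apply: (@Ck_onS_intro _ R^o n k U _
  (fun a x => (2 * Num.sqrt (f x))^-1 * 'D_(delta_mx 0 a) f x)) => //.
- by move=> x /H[].
- by move=> a x /H[].
- move=> a; apply: Ck_onM (Hf a) => //; apply: Ck_on_inv => //.
    by move=> x Ux; rewrite mulf_neq0 ?pnatr_eq0 // gt_eqF // sqrtr_gt0 f0.
  by apply: Ck_onM => //; exact: Ck_on_cst.
Qed.

Lemma Ck_on_sum n k (U : set 'rV[R]_n) (W : normedModType R) m
    (f : 'I_m -> 'rV[R]_n -> W) : open U ->
  (forall i, Ck_on k U (f i)) -> Ck_on k U (fun x => \sum_i f i x).
Proof.
move=> oU H; rewrite (_ : (fun x => _) = \sum_i f i); last first.
  by apply/funext => x; rewrite fct_sumE.
elim/big_ind : _ => //; first exact: (Ck_on_cst k 0 oU).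
by move=> g h Hg Hh; exact: (Ck_onD oU Hg Hh).
Qed.

Lemma differentiable_mxP (V : normedModType R) p q (M : V -> 'M[R]_(p, q)) x :
  differentiable M x <-> forall i j, differentiable (fun y => M y i j : R^o) x.
Proof.
split=> [dM i j|dM].
  exact: (differentiable_comp dM (differentiable_coord (M x) i j)).
rewrite (_ : M = \sum_i \sum_j (fun y => M y i j *: delta_mx i j)).
  do 2 apply: differentiable_sum => ?.
  exact: differentiableZl.
apply/funext => y; rewrite {1}[M y]matrix_sum_delta !fct_sumE.
by apply: eq_bigr => i _; rewrite fct_sumE.
Qed.

Lemma derive_coord (V : normedModType R) p q (M : V -> 'M[R]_(p, q)) x v i j :
  differentiable M x -> ('D_v M x) i j = 'D_v (fun y => M y i j : R^o) x.
Proof. by move=> /diff_derivable/derive_mx ->; rewrite mxE. Qed.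

Lemma Ck_on_mxP n k (U : set 'rV[R]_n) p q (M : 'rV[R]_n -> 'M[R]_(p, q)) :
  open U ->
  Ck_on k U M <-> forall i j, Ck_on k U (fun x => M x i j : R^o).
Proof.
move=> oU; split.
  elim: k M => [|k IH] M.
    move=> HM i j x Ux.
    apply: (@continuous_comp _ _ _ M (fun N : 'M[R]_(p, q) => N i j : R^o) x).
      exact: HM.
    exact: coord_continuous.
  move=> /Ck_onS[dM HM] i j.
  apply: (@Ck_onS_intro _ R^o n k U _
    (fun a x => ('D_(delta_mx 0 a) M x) i j)) => //.
  - by move=> x /dM/differentiable_mxP.
  - by move=> a x /dM ?; rewrite derive_coord.
  - by move=> a; exact: IH.
elim: k M => [|k IH] M HM.
  move=> x Ux; have [_] := @cvgrPdist_lt _ _ _ (nbhs x) _ M (M x).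
  apply=> e e0; near=> y.
  rewrite /Num.Def.normr/= mx_normrE (bigmax_lt _ e0)//= => i _.
  rewrite !mxE /=; move: i; near: y; apply: filter_forall => -[i j] /=.
  have [+ _] := @cvgrPdist_lt _ _ _ (nbhs x) _ (fun y => M y i j : R^o) (M x i j).
  by apply => //; exact: HM.
have dM x : U x -> differentiable M x.
  by move=> Ux; apply/differentiable_mxP => i j; have [+ _] := HM i j; exact.
split=> // a; apply: IH => i j.
have /Ck_onS[_ /(_ a)] := HM i j.
by apply: Ck_on_eq => // x /dM ?; rewrite derive_coord.
Unshelve. all: by end_near. Qed.

Lemma Ck_on_comp n m k (U : set 'rV[R]_n) (V : set 'rV[R]_m)
    (f : 'rV[R]_n -> 'rV[R]_m) (g : 'rV[R]_m -> R^o) : open U ->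
  (forall x, U x -> V (f x)) ->
  Ck_on k U f -> Ck_on k V g -> Ck_on k U (g \o f : _ -> R^o).
Proof.
move=> oU UV; elim: k g => [|k IH] g.
  by move=> Hf Hg x Ux; apply: continuous_comp (Hf x Ux) (Hg _ (UV _ Ux)).
move=> Hf' /Ck_onS[dg Hg]; have [df Hf] := Ck_onS Hf'.
apply: (@Ck_onS_intro _ R^o n k U _
  (fun a x => \sum_b ('D_(delta_mx 0 a) f x) 0 b
                      * ('D_(delta_mx 0 b) g \o f) x)) => //.
- by move=> x Ux; apply: differentiable_comp; [exact: df|exact/dg/UV].
- move=> a x Ux; rewrite derive_comp; [|exact: df|exact/dg/UV].
  by rewrite derive_rowE //; exact/dg/UV.
- move=> a; apply: Ck_on_sum => // b; apply: Ck_onM => //.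
    by have /(Ck_on_mxP _ _ oU) := Hf a; apply.
  exact: IH (Ck_onW Hf') (Hg b).
Qed.

End Calculus2.

(** * Symmetry of second derivatives *)

Section Schwarz.
Context {R : realType}.

Lemma mvt_along (V : normedModType R) (f : V -> R^o) (x u : V) (t : R) :
  0 < t -> (forall s, 0 <= s <= t -> differentiable f (s *: u + x)) ->
  exists c, 0 < c < t /\ f (t *: u + x) - f x = t * 'D_u f (c *: u + x).
Proof.
move=> t0 df; pose p (s : R^o) : V := s *: u + x.
have dp s : differentiable p s by apply: differentiableD.
have Dp s : 'D_1 p s = u.
  rewrite deriveD ?derive_cst ?addr0; last 2 first.
  - exact: diff_derivable.
  - exact: diff_derivable.
  by rewrite deriveE // diff_val /= scale1r.
have fp s : 0 <= s <= t -> is_derive s 1 (f \o p : R^o -> R^o) ('D_u f (p s)).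
  move=> /df d; split; first exact/diff_derivable/differentiable_comp.
  by rewrite derive_comp // Dp.
have fp' s : s \in `]0, t[ -> is_derive s 1 (f \o p : R^o -> R^o) ('D_u f (p s)).
  by rewrite in_itv /= => /andP[s0 st]; apply: fp; rewrite !ltW.
have cp : {within `[0, t], continuous (f \o p : R^o -> R^o)}.
  apply: derivable_within_continuous => s; rewrite in_itv /= => sI.
  by have [] := fp s sI.
have [c + E] := MVT t0 fp' cp.
rewrite in_itv /= => cI; exists c; split => //.
by move: E; rewrite /p /= scale0r add0r subr0 mulrC.
Qed.

Lemma derive_translate (V W : normedModType R) (f : V -> W) (h x u : V) :
  'D_u (fun y => f (y + h)) x = 'D_u f (x + h).
Proof.
apply: (congr1 (fun g : R -> W => lim (g @ 0^'))); apply/funext => s /=.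
by rewrite addrA.
Qed.

(* Two applications of the mean value theorem; the left-hand side is symmetric
   in [a] and [b], which yields the symmetry of second derivatives. *)
Lemma second_difference (V : normedModType R) (f : V -> R^o) (x a b : V) (t : R) :
  0 < t ->
  (forall s s', 0 <= s <= t -> 0 <= s' <= t ->
     differentiable f (s *: a + (s' *: b + x)) /\
     differentiable ('D_a f) (s *: a + (s' *: b + x))) ->
  exists c c', [/\ 0 < c < t, 0 < c' < t &
    f (t *: a + (t *: b + x)) - f (t *: b + x) - (f (t *: a + x) - f x) =
    t * (t * 'D_b ('D_a f) (c *: a + (c' *: b + x)))].
Proof.
(* The double difference is the increment of [F] along [t *: a], and the derivative of [F] along [a]
   is the increment of ['D_a f] along [t *: b]. *)
move=> t0 H; pose F y := f (y + t *: b) - f y.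
have tt : 0 <= t <= t by rewrite lexx ltW.
have oo : 0 <= (0 : R) <= t by rewrite lexx ltW.
have shift s s' : s *: a + x + s' *: b = s *: a + (s' *: b + x).
  by rewrite -addrA [x + _]addrC.
have df s : 0 <= s <= t -> differentiable f (s *: a + x).
  by move=> /H/(_ oo)[]; rewrite scale0r add0r.
have dft s : 0 <= s <= t -> differentiable (fun y => f (y + t *: b)) (s *: a + x).
  move=> /H/(_ tt)[d _].
  apply: (@differentiable_comp _ _ _ _ (fun y => y + t *: b)).
    exact: differentiableD.
  by rewrite shift.
have [c [cI E]] : exists c, 0 < c < t /\
    F (t *: a + x) - F x = t * 'D_a F (c *: a + x).
  apply: mvt_along => // s sI; apply: differentiableB; [exact: dft|exact: df].
have cI' : 0 <= c <= t by case/andP: cI => ? ?; rewrite !ltW.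
have [c' [cI'' E']] := @mvt_along V ('D_a f) (c *: a + x) b t t0
  (fun s sI => ltac:(by rewrite addrCA; have [] := H c s cI' sI)).
exists c, c'; split => //.
rewrite [c *: a + (c' *: b + x)]addrCA -E' [t *: b + (c *: a + x)]addrC.
rewrite -derive_translate.
rewrite -deriveB; last 2 first.
- exact/diff_derivable/dft.
- exact/diff_derivable/df.
rewrite -[X in 'D_a X _]/F -E /F shift [x + _]addrC.
ring.
Qed.

(** The points [y] and [z] may differ: the two orders of differentiation yield unrelated
    intermediate points, both tending to [x]. *)
Lemma eq_at_limit (V : normedModType R) (F G : V -> R^o) (x : V) :
  {for x, continuous F} -> {for x, continuous G} ->
  (forall r, 0 < r -> exists y z, [/\ `|x - y| < r, `|x - z| < r & F y = G z]) ->
  F x = G x.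
Proof.
move=> cF cG H; apply/eqP; rewrite -subr_eq0 -normr_le0; apply/ler_addgt0Pr => e e0.
have e2 : 0 < e / 2 by rewrite divr_gt0.
have [/(_ cF _ e2)/nbhs_ballP[r1 /= r10 Hr1] _] :=
  @cvgrPdist_lt _ _ _ (nbhs x) (nbhs_filter x) F (F x).
have [/(_ cG _ e2)/nbhs_ballP[r2 /= r20 Hr2] _] :=
  @cvgrPdist_lt _ _ _ (nbhs x) (nbhs_filter x) G (G x).
have [y [z [xy xz yz]]] : exists y z,
    [/\ `|x - y| < Num.min r1 r2, `|x - z| < Num.min r1 r2 & F y = G z].
  by apply: H; rewrite lt_min r10.
have {}Hr1 : `|F x - F y| < e / 2.
  by apply: Hr1; rewrite -ball_normE /=; apply: lt_le_trans xy _; rewrite ge_min lexx.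
have {}Hr2 : `|G x - G z| < e / 2.
  by apply: Hr2; rewrite -ball_normE /=; apply: lt_le_trans xz _; rewrite ge_min lexx orbT.
rewrite add0r -(subrKA (F y)) [e]splitr.
apply: le_trans (ler_normD _ _) _.
by rewrite {2}yz [X in _ + X]distrC lerD // ltW.
Qed.

Lemma derive_comm n (U : set 'rV[R]_n) (f : 'rV[R]_n -> R^o) x i j :
  open U -> Ck_on 2 U f -> U x ->
  'D_(delta_mx 0 i) ('D_(delta_mx 0 j) f) x =
  'D_(delta_mx 0 j) ('D_(delta_mx 0 i) f) x.
Proof.
move=> oU f2 Ux; have [df dDf] := Ck_onS f2.
have d2 k y (Uy : U y) := (Ck_onS (dDf k)).1 y Uy.
set a := delta_mx 0 i; set b := delta_mx 0 j.
apply: (@eq_at_limit _ ('D_a ('D_b f)) ('D_b ('D_a f)) x).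
- exact: ((Ck_onS (dDf j)).2 i x Ux).
- exact: ((Ck_onS (dDf i)).2 j x Ux).
have /nbhs_ballP[r0 /= r00 Hr0] := open_nbhs_nbhs (conj oU Ux).
move=> r1 r10; pose r := Num.min r0 r1.
have r_gt0 : 0 < r by rewrite lt_min r00.
(* With [t = r / K] the parallelogram spanned by [t *: a] and [t *: b] stays within [r] of [x]; the
   extra 1 makes [K] positive and the bound strict. *)
pose K := `|a| + `|b| + 1; have K0 : 0 < K by rewrite ltr_wpDl // addr_ge0.
pose t := r / K; have t0 : 0 < t by rewrite divr_gt0.
have near_x s s' : 0 <= s <= t -> 0 <= s' <= t ->
    `|x - (s *: a + (s' *: b + x))| < r.
  move=> /andP[s0 st] /andP[s0' st'].
  rewrite addrA opprD addrCA subrr addr0 normrN.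
  apply: le_lt_trans (ler_normD _ _) _; rewrite !normrZ !ger0_norm //.
  apply: (@le_lt_trans _ _ (t * (`|a| + `|b|))).
    by rewrite mulrDr lerD // ler_wpM2r.
  by rewrite -[ltRHS](divfK (lt0r_neq0 K0)) ltr_pM2l // ltrDl.
have near_U s s' : 0 <= s <= t -> 0 <= s' <= t -> U (s *: a + (s' *: b + x)).
  move=> sI sI'; apply: Hr0; rewrite -ball_normE /=.
  by apply: lt_le_trans (near_x _ _ sI sI') _; rewrite ge_min lexx.
have near_r s s' : 0 < s < t -> 0 < s' < t ->
    `|x - (s *: a + (s' *: b + x))| < r1.
  move=> /andP[s0 st] /andP[s0' st'].
  apply: lt_le_trans (near_x _ _ _ _) _; rewrite ?(ltW s0) ?(ltW st) ?(ltW s0') ?(ltW st') //.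
  by rewrite ge_min lexx orbT.
have [c [c' [cI cI' E]]] := @second_difference _ f x a b t t0
  (fun s s' sI sI' => conj (df _ (near_U s s' sI sI')) (d2 i _ (near_U s s' sI sI'))).
have near_U' s s' : 0 <= s <= t -> 0 <= s' <= t -> U (s *: b + (s' *: a + x)).
  by move=> sI sI'; rewrite addrCA; exact: near_U.
have [d [d' [dI dI' E']]] := @second_difference _ f x b a t t0
  (fun s s' sI sI' => conj (df _ (near_U' s s' sI sI')) (d2 j _ (near_U' s s' sI sI'))).
exists (d *: b + (d' *: a + x)), (c *: a + (c' *: b + x)); split.
- by rewrite addrCA; exact: near_r.
- exact: near_r.
have EE : f (t *: b + (t *: a + x)) - f (t *: a + x) - (f (t *: b + x) - f x) =
          f (t *: a + (t *: b + x)) - f (t *: b + x) - (f (t *: a + x) - f x).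
  rewrite [t *: b + (t *: a + _)]addrCA.
  set A := f _; set B := f _; set C := f _; set D := f _.
  by rewrite !opprB addrACA [- B + _]addrC -addrACA.
rewrite E E' in EE.
exact: (mulfI (lt0r_neq0 t0) (mulfI (lt0r_neq0 t0) EE)).
Qed.

End Schwarz.

(** * A flat function on the line *)

Section Bump.
Context {R : realType}.

(* [flat 0] is the usual flat function; the family is closed under
   differentiation, up to linear combinations. *)
Definition flat (n : nat) (t : R) : R :=
  if 0 < t then (t^-1) ^+ n * expR (- t^-1) else 0.

(** The term of degree n+2 in the exponential series of [t^-1] absorbs [(t^-1) ^+ n] and leaves the
    factor [t ^+ 2], one power more than continuity of the difference quotient at 0 requires to give
    derivative 0. *)
Lemma flat_bound n t : `|flat n t| <= n.+2`!%:R * t ^+ 2.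
Proof.
rewrite /flat; case: ifPn => [t0|_]; last by rewrite normr0 mulr_ge0 // sqr_ge0.
have ti0 : 0 < t^-1 by rewrite invr_gt0.
rewrite ger0_norm ?mulr_ge0 ?expR_ge0 ?exprn_ge0 ?(ltW ti0) //.
rewrite expRN ler_pdivrMr ?expR_gt0 //.
have F0 : 0 < n.+2`!%:R :> R by rewrite ltr0n fact_gt0.
set F := n.+2`!%:R in F0 *.
have H : (t^-1) ^+ n.+2 / F <= expR (t^-1).
  by apply: le_trans (expR_ge1Dxn n.+1 (ltW ti0)); rewrite lerDr.
rewrite -ler_pdivrMl ?mulr_gt0 ?exprn_gt0 //.
apply: le_trans H; rewrite le_eqVlt; apply/orP; left; apply/eqP.
by rewrite invfM -exprVn -[in RHS]addn2 exprD; ring.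
Qed.

Lemma is_derive_flat n (t : R^o) :
  is_derive t 1 (flat n : R^o -> R^o) (flat n.+2 t - n%:R * flat n.+1 t).
Proof.
have [t0|t0|->] := ltrgtP t 0.
- apply: (@near_eq_is_derive _ _ _ (cst 0)); last first.
    rewrite /flat !ifN ?mulr0 ?subr0 -?leNgt ?ltW //; exact: is_derive_cst.
  near=> s; rewrite /flat ifN // -leNgt ltW //; near: s.
  exact: lt_nbhsl.
- apply: (@near_eq_is_derive _ _ _ (fun s : R^o => (s^-1) ^+ n * expR (- s^-1))).
    near=> s; rewrite /flat ifT //; near: s; exact: lt_nbhsr.
  rewrite /flat t0.
  have t0' : t != 0 by rewrite gt_eqF.
  have dV : is_derive t 1 (fun s : R^o => s^-1) (- t ^- 2).
    by apply: is_derive_eq; first exact: is_deriveV; rewrite /GRing.scale /= mulr1.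
  have dE : is_derive t 1 (fun s : R^o => expR (- s^-1)) (t ^- 2 * expR (- t^-1)).
    have dN : is_derive t 1 (fun s : R^o => - s^-1) (t ^- 2).
      exact: (is_derive_eq (is_deriveN dV) (opprK _)).
    exact: (is_derive_eq (is_derive1_comp (is_derive_expR _) dN) (mulrC _ _)).
  rewrite (_ : (fun s => _) =
      (fun s : R^o => s^-1) ^+ n * (fun s => expR (- s^-1)) :> (R^o -> R)); last first.
    by apply/funext => s; rewrite !fctE.
  apply: (is_derive_eq (is_deriveM (is_deriveX n dV) dE)).
  rewrite /GRing.scale /= fctE -!exprVn; set y := t^-1; set E := expR _.
  case: n => [|n] /=; first by rewrite !expr0; ring.
  by rewrite !exprS expr0; ring.
- have f0 m : flat m 0 = 0 by rewrite /flat ltxx.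
  rewrite !f0 mulr0 subr0.
  (* By [flat_bound] the difference quotient at 0 is at most (n+2)! |h| in absolute value. *)
  have C : (fun h : R => h^-1 *: ((flat n \o shift (0 : R)) (h *: (1 : R)) -
      flat n 0)) @ 0^' --> (0 : R^o).
    apply/cvgrPdist_le => e e0; near=> h.
    have h0 : h != 0 by near: h; exact: nbhs_dnbhs_neq.
    rewrite f0 sub0r normrN subr0 /= addr0 /GRing.scale /= mulr1 normrM normfV.
    rewrite ler_pdivrMl ?normr_gt0 //.
    apply: le_trans (flat_bound n h) _.
    rewrite -real_normK ?num_real // expr2 mulrA [leRHS]mulrC ler_wpM2r //.
    rewrite -ler_pdivlMl ?ltr0n ?fact_gt0 //.
    near: h; apply: dnbhs0_le; rewrite mulr_gt0 ?invr_gt0 ?ltr0n ?fact_gt0 //.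
  split; first by apply/cvg_ex; exists 0.
  exact: cvg_lim.
Unshelve. all: by end_near. Qed.

(** The induction on [k] treats all [m] at once, since differentiating [flat m] brings in the
    indices m+1 and m+2. *)
Lemma Ck_on_flat n k (U : set 'rV[R]_n) (q : 'rV[R]_n -> R^o) m : open U ->
  Ck_on k U q -> Ck_on k U (fun x => flat m (q x) : R^o).
Proof.
move=> oU; elim: k m => [|k IH] m.
  move=> Hq x Ux; apply: continuous_comp (Hq x Ux) _.
  have [+ _] := is_derive_flat m (q x).
  by move=> /derivable1_diffP; exact: differentiable_continuous.
move=> Hq'; have [dq Hq] := Ck_onS Hq'.
have H x (Ux : U x) := derive_comp1 (dq x Ux) (is_derive_flat m (q x)).
apply: (@Ck_onS_intro _ R^o n k U _ (fun a x =>
  (flat m.+2 (q x) + (- m%:R) * flat m.+1 (q x)) * 'D_(delta_mx 0 a) q x)) => //.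
- by move=> x /H[].
- by move=> a x /H[_ ->]; rewrite mulNr.
- move=> a; apply: Ck_onM (Hq a) => //; apply: Ck_onD => //.
    exact: IH (Ck_onW Hq').
  by apply: Ck_onM => //; [exact: Ck_on_cst|exact: IH (Ck_onW Hq')].
Qed.

End Bump.

(** * Algebra of smooth scalar and matrix functions *)

Section SmoothAlgebra.
Context {R : realType} {n : nat} {U : set 'rV[R]_n}.
Hypothesis oU : open U.
Implicit Types f g : 'rV[R]_n -> R^o.

Lemma smooth_cst (W : normedModType R) (c : W) : smooth_on U (fun=> c).
Proof. by move=> k; exact: Ck_on_cst. Qed.

Lemma smoothD f g : smooth_on U f -> smooth_on U g ->
  smooth_on U (fun x => f x + g x : R^o).
Proof. by move=> Hf Hg k; apply: Ck_onD. Qed.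

Lemma smoothM f g : smooth_on U f -> smooth_on U g ->
  smooth_on U (fun x => f x * g x : R^o).
Proof. by move=> Hf Hg k; apply: Ck_onM. Qed.

Lemma smoothB f g : smooth_on U f -> smooth_on U g ->
  smooth_on U (fun x => f x - g x : R^o).
Proof.
move=> Hf Hg k; apply: Ck_onD (Hf k) _ => //.
apply: (@Ck_on_eq _ _ _ _ _ (fun x => (-1) * g x : R^o)) => //.
  by move=> x _; rewrite mulN1r.
by apply: Ck_onM => //; exact: Ck_on_cst.
Qed.

Lemma smooth_sum m (F : 'I_m -> 'rV[R]_n -> R^o) :
  (forall i, smooth_on U (F i)) -> smooth_on U (fun x => \sum_i F i x : R^o).
Proof. by move=> H k; apply: Ck_on_sum => // i; exact: H. Qed.

Lemma smoothV f : (forall x, U x -> f x != 0) -> smooth_on U f ->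
  smooth_on U (fun x => (f x)^-1 : R^o).
Proof. by move=> f0 Hf k; apply: Ck_on_inv. Qed.

Lemma smooth_sqrt f : (forall x, U x -> 0 < f x) -> smooth_on U f ->
  smooth_on U (fun x => Num.sqrt (f x) : R^o).
Proof. by move=> f0 Hf k; apply: Ck_on_sqrt. Qed.

Lemma smooth_mxP p q (M : 'rV[R]_n -> 'M[R]_(p, q)) :
  smooth_on U M <-> forall i j, smooth_on U (fun x => M x i j : R^o).
Proof.
split=> [H i j k|H k]; first exact: (Ck_on_mxP k M oU).1 (H k) i j.
by apply: (Ck_on_mxP k M oU).2 => i j; exact: H.
Qed.

Lemma smooth_comp m (V : set 'rV[R]_m) (f : 'rV[R]_n -> 'rV[R]_m)
    (g : 'rV[R]_m -> R^o) : (forall x, U x -> V (f x)) ->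
  smooth_on U f -> smooth_on V g -> smooth_on U (g \o f : _ -> R^o).
Proof. by move=> UV Hf Hg k; apply: Ck_on_comp UV (Hf k) (Hg k). Qed.

Lemma smooth_mulmx p q r (A : 'rV[R]_n -> 'M[R]_(p, q))
    (B : 'rV[R]_n -> 'M[R]_(q, r)) :
  smooth_on U A -> smooth_on U B -> smooth_on U (fun x => A x *m B x).
Proof.
move=> /smooth_mxP HA /smooth_mxP HB; apply/smooth_mxP => i j.
rewrite (_ : (fun x => _) = fun x => \sum_k A x i k * B x k j).
  by apply: smooth_sum => k; exact: smoothM.
by apply/funext => x; rewrite mxE.
Qed.

Lemma smooth_det p (A : 'rV[R]_n -> 'M[R]_p) :
  (forall i j, smooth_on U (fun x => A x i j : R^o)) ->
  smooth_on U (fun x => \det (A x) : R^o).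
Proof.
elim: p A => [|p IH] A HA.
  rewrite (_ : (fun x => _) = fun=> 1); first exact: smooth_cst.
  by apply/funext => x; rewrite det_mx00.
rewrite (_ : (fun x => _) = fun x => \sum_j A x 0 j *
   ((-1) ^+ (0 + j) * \det (row' 0 (col' j (A x))))).
  apply: smooth_sum => j; apply: smoothM => //; apply: smoothM.
    exact: smooth_cst.
  apply: IH => i k; rewrite (_ : (fun x => _) = fun x => A x (lift 0 i) (lift j k)) //.
  by apply/funext => x; rewrite !mxE.
by apply/funext => x; rewrite (expand_det_row _ 0).
Qed.

Lemma smooth_invmx p (A : 'rV[R]_n -> 'M[R]_p) :
  (forall x, U x -> A x \in unitmx) ->
  smooth_on U A -> smooth_on U (fun x => invmx (A x)).
Proof.
move=> uA /smooth_mxP HA; apply/smooth_mxP => i j.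
apply: (@smooth_on_eq _ _ _ _ (fun x => (\det (A x))^-1 *
   ((-1) ^+ (j + i) * \det (row' j (col' i (A x)))))) => //.
  by move=> x Ux; rewrite /invmx uA // !mxE.
apply: smoothM.
  apply: smoothV; last exact: smooth_det.
  by move=> x /uA; rewrite unitmxE unitfE.
apply: smoothM; first exact: smooth_cst.
apply: smooth_det => k l.
rewrite (_ : (fun x => _) = fun x => A x (lift j k) (lift i l)) //.
by apply/funext => x; rewrite !mxE.
Qed.

End SmoothAlgebra.

(** * Vector algebra in a 3-dimensional Euclidean space *)

(** The three indices have the shape produced by [big_ord_recl], so that unfolded sums need no
    conversion of ordinals. *)
Local Notation o0 := (ord0 : 'I_3).
Local Notation o1 := (lift ord0 ord0 : 'I_3).
Local Notation o2 := (lift ord0 (lift ord0 ord0) : 'I_3).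

Section Algebra3.
Context {R : realType}.
Implicit Types (u v w : 'rV[R]_3) (A G J N : 'M[R]_3).

Lemma sum3 (V : nmodType) (F : 'I_3 -> V) : \sum_i F i = F o0 + F o1 + F o2.
Proof. by rewrite !big_ord_recl big_ord0 addr0 addrA. Qed.

Lemma forall_ord3 (P : 'I_3 -> Prop) : P o0 -> P o1 -> P o2 -> forall i, P i.
Proof.
move=> P0 P1 P2 i.
case: (unliftP ord0 i) => [j ->|-> //]; case: (unliftP ord0 j) => [k ->|-> //].
by rewrite (ord1 k).
Qed.

Let lift2 : lift (lift ord0 ord0) ord0 = ord0 :> 'I_2.
Proof. exact: val_inj. Qed.

Let lift3 : (lift o1 ord0 = o0) * (lift o1 (lift ord0 ord0) = o2) *
  (lift o2 ord0 = o0) * (lift o2 (lift ord0 ord0) = o1).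
Proof. by do !split; exact: val_inj. Qed.

Lemma det3 A : \det A =
  A o0 o0 * (A o1 o1 * A o2 o2 - A o1 o2 * A o2 o1)
  - A o0 o1 * (A o1 o0 * A o2 o2 - A o1 o2 * A o2 o0)
  + A o0 o2 * (A o1 o0 * A o2 o1 - A o1 o1 * A o2 o0).
Proof.
have det2 (B : 'M[R]_2) : \det B =
    B ord0 ord0 * B (lift ord0 ord0) (lift ord0 ord0)
    - B ord0 (lift ord0 ord0) * B (lift ord0 ord0) ord0.
  rewrite (expand_det_row _ ord0) !big_ord_recl big_ord0 addr0 /cofactor.
  by rewrite !det_mx11 !mxE !lift2 /= expr0 expr1; ring.
rewrite (expand_det_row _ ord0) sum3 /cofactor !det2 !mxE !lift3 /=.
by rewrite !expr0 expr1; ring.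
Qed.

Lemma mulrow3 u m (A : 'M[R]_(3, m)) j :
  (u *m A) 0 j = u 0 o0 * A o0 j + u 0 o1 * A o1 j + u 0 o2 * A o2 j.
Proof. by rewrite mxE sum3. Qed.

(** The Euclidean cross product, to be thought of as the covector w |-> det (u, v, w). This is why
    [A^T] appears in its behaviour under a linear map, and why [crossm] composes it with [invmx G]
    to raise the index. *)
Definition vect u v : 'rV[R]_3 := \row_k \det (rows3 u v (delta_mx 0 k)).

Lemma rows3E u v w : ((forall j, rows3 u v w o0 j = u 0 j) *
  (forall j, rows3 u v w o1 j = v 0 j) * (forall j, rows3 u v w o2 j = w 0 j))%type.
Proof. by do !split; move=> j; rewrite mxE. Qed.

Lemma vectE u v :
  (vect u v 0 o0 = u 0 o1 * v 0 o2 - u 0 o2 * v 0 o1) *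
  (vect u v 0 o1 = u 0 o2 * v 0 o0 - u 0 o0 * v 0 o2) *
  (vect u v 0 o2 = u 0 o0 * v 0 o1 - u 0 o1 * v 0 o0).
Proof.
do !split; rewrite /vect mxE det3 !rows3E !mxE /=; ring.
Qed.

Lemma det_rows3 u v w : \det (rows3 u v w) = (vect u v *m w^T) 0 0.
Proof. by rewrite mulrow3 !vectE det3 !rows3E !mxE; ring. Qed.

(** Paired with w, both sides become det (u A, v A, w A) = det A det (u, v, w). *)
Lemma vect_mulmx A u v :
  vect (u *m A) (v *m A) *m A^T = \det A *: vect u v.
Proof.
apply/rowP; apply: forall_ord3; rewrite mulrow3 [RHS]mxE !vectE !mulrow3 det3 !mxE; ring.
Qed.

Lemma vect_vect u v w :
  vect u (vect v w) = (u *m w^T) 0 0 *: v - (u *m v^T) 0 0 *: w.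
Proof.
have L k (a b : R) : (a *: v - b *: w) 0 k = a * v 0 k - b * w 0 k.
  by rewrite !mxE.
by apply/rowP; apply: forall_ord3; rewrite L !vectE !mulrow3 !mxE; ring.
Qed.

(** Derivative at t = 0 of [vect_mulmx] for the matrix 1 + t A. It accounts for all the connection
    terms in [nabla_cross]. *)
Lemma vect_derivation A u v :
  \tr A *: vect u v - vect u v *m A^T = vect (u *m A) v + vect u (v *m A).
Proof.
have L k (a : R) (x y : 'rV[R]_3) : (a *: x - y) 0 k = a * x 0 k - y 0 k.
  by rewrite !mxE.
have L' k (x y : 'rV[R]_3) : (x + y) 0 k = x 0 k + y 0 k by rewrite mxE.
apply/rowP; apply: forall_ord3;
  by rewrite L L' !mulrow3 !vectE !mulrow3 /mxtrace sum3 !mxE; ring.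
Qed.

Lemma vectC u v : vect v u = - vect u v.
Proof. by apply/rowP; apply: forall_ord3; rewrite !vectE [RHS]mxE !vectE; ring. Qed.

Lemma vectDr u v w : vect u (v + w) = vect u v + vect u w.
Proof.
by apply/rowP; apply: forall_ord3; rewrite !vectE [RHS]mxE !vectE !mxE; ring.
Qed.

Lemma vectZr u v a : vect u (a *: v) = a *: vect u v.
Proof.
by apply/rowP; apply: forall_ord3; rewrite !vectE [RHS]mxE !vectE !mxE; ring.
Qed.

Lemma mxtrace_similar (A B J : 'M[R]_3) :
  J \in unitmx -> A *m J = J *m B -> \tr A = \tr B.
Proof.
by move=> uJ E; rewrite -[A](mulmxK uJ) E -mulmxA mxtrace_mulC mulmxKV.
Qed.

Lemma intertwine_mul (A B A' B' J : 'M[R]_3) :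
  A *m J = J *m A' -> B *m J = J *m B' -> A *m B *m J = J *m (A' *m B').
Proof. by move=> HA HB; rewrite -mulmxA HB mulmxA HA -mulmxA. Qed.

End Algebra3.

(** * Inner and cross products defined by a Gram matrix *)

Section Metric3.
Context {R : realType}.
Implicit Types (u v w : 'rV[R]_3) (A G J N : 'M[R]_3) (a : R).

Definition dotm G u v : R := (u *m G *m v^T) 0 0.

Definition crossm G u v : 'rV[R]_3 :=
  Num.sqrt (\det G) *: (vect u v *m invmx G).

Lemma dotmDl G u v w : dotm G (u + v) w = dotm G u w + dotm G v w.
Proof. by rewrite /dotm !mulmxDl mxE. Qed.

Lemma dotmZl G a u v : dotm G (a *: u) v = a * dotm G u v.
Proof. by rewrite /dotm -!scalemxAl mxE. Qed.

Lemma dotmDr G u v w : dotm G u (v + w) = dotm G u v + dotm G u w.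
Proof. by rewrite /dotm linearD mulmxDr mxE. Qed.

Lemma dotmZr G a u v : dotm G u (a *: v) = a * dotm G u v.
Proof. by rewrite /dotm linearZ -scalemxAr mxE. Qed.

Lemma dotmNl G u v : dotm G (- u) v = - dotm G u v.
Proof. by rewrite -scaleN1r dotmZl mulN1r. Qed.

Lemma dotmNr G u v : dotm G u (- v) = - dotm G u v.
Proof. by rewrite -scaleN1r dotmZr mulN1r. Qed.

Lemma dotm0l G v : dotm G 0 v = 0.
Proof. by rewrite /dotm !mul0mx mxE. Qed.

Lemma dotm0r G v : dotm G v 0 = 0.
Proof. by rewrite /dotm trmx0 mulmx0 mxE. Qed.

Definition dotmE := (dotmDl, dotmDr, dotmNl, dotmNr, dotmZl, dotmZr, dotm0l, dotm0r).

Lemma dotmC G u v : G^T = G -> dotm G u v = dotm G v u.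
Proof.
move=> GT; rewrite /dotm -[v *m G *m u^T]trmxK [RHS]mxE !trmx_mul trmxK GT.
by rewrite mulmxA.
Qed.

Lemma dotm_mul G A u v : dotm G (u *m A) v = dotm (A *m G) u v.
Proof. by rewrite /dotm mulmxA. Qed.

Lemma dotm_mulr G A u v : dotm G u (v *m A) = dotm (G *m A^T) u v.
Proof. by rewrite /dotm trmx_mul !mulmxA. Qed.

Lemma dotm_congr J G u v :
  dotm (J *m G *m J^T) u v = dotm G (u *m J) (v *m J).
Proof. by rewrite dotm_mul dotm_mulr. Qed.

Lemma dotm_inj G u v : G \in unitmx ->
  (forall w, dotm G u w = dotm G v w) -> u = v.
Proof.
move=> uG H; apply: (can_inj (mulmxK uG)); apply/rowP => k.
by have := H (delta_mx 0 k); rewrite /dotm trmx_delta -!colE [LHS]mxE [RHS]mxE.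
Qed.

(* Sylvester's criterion: the test vectors are built from the cofactors of the
   successive leading minors. *)
Lemma posdef_det_gt0 G : G^T = G ->
  (forall v, v != 0 -> 0 < dotm G v v) -> 0 < \det G.
Proof.
move=> GT pos.
have Gs k l : G k l = G l k by rewrite -{1}GT mxE.
pose row3 (a b c : R) : 'rV[R]_3 := \row_k [:: a; b; c]`_k.
have r3 a b c : (row3 a b c 0 o0 = a) * (row3 a b c 0 o1 = b) * (row3 a b c 0 o2 = c).
  by do !split; rewrite mxE.
have D a b c : dotm G (row3 a b c) (row3 a b c) =
    a * (a * G o0 o0 + b * G o1 o0 + c * G o2 o0) +
    b * (a * G o0 o1 + b * G o1 o1 + c * G o2 o1) +
    c * (a * G o0 o2 + b * G o1 o2 + c * G o2 o2).
  by rewrite /dotm mulrow3 !mulrow3 !r3 ![_^T _ _]mxE !r3; ring.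
have nz a b c k : row3 a b c 0 k != 0 -> row3 a b c != 0.
  by apply: contraNneq => ->; rewrite mxE.
have m1 : 0 < G o0 o0.
  have := pos (row3 1 0 0); rewrite D !mul0r !mul1r !addr0; apply.
  by apply: (nz _ _ _ o0); rewrite r3 oner_neq0.
pose m := G o0 o0 * G o1 o1 - G o0 o1 * G o0 o1.
have m2 : 0 < m.
  have := pos (row3 (- G o0 o1) (G o0 o0) 0); rewrite D.
  rewrite [ltRHS](_ : _ = G o0 o0 * m); last by rewrite (Gs o1 o0) /m; ring.
  rewrite pmulr_rgt0 //; apply.
  by apply: (nz _ _ _ o1); rewrite r3 gt_eqF.
have := pos (row3 (G o0 o1 * G o1 o2 - G o0 o2 * G o1 o1)
                  (G o0 o2 * G o0 o1 - G o0 o0 * G o1 o2) m); rewrite D.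
rewrite [ltRHS](_ : _ = m * \det G); last first.
  by rewrite det3 (Gs o1 o0) (Gs o2 o0) (Gs o2 o1) /m; ring.
rewrite pmulr_rgt0 //; apply.
by apply: (nz _ _ _ o2); rewrite r3 gt_eqF.
Qed.

Section Cross.
Variable G : 'M[R]_3.
Hypotheses (GT : G^T = G) (detG : 0 < \det G).

Let sG : Num.sqrt (\det G) != 0.
Proof. by rewrite gt_eqF // sqrtr_gt0. Qed.

Let uG : G \in unitmx.
Proof. by rewrite unitmxE unitfE gt_eqF. Qed.

Lemma crossmG u v : crossm G u v *m G = Num.sqrt (\det G) *: vect u v.
Proof. by rewrite /crossm -scalemxAl mulmxKV. Qed.

Lemma dotm_crossm u v w :
  dotm G (crossm G u v) w = Num.sqrt (\det G) * \det (rows3 u v w).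
Proof. by rewrite /dotm crossmG -scalemxAl mxE det_rows3. Qed.

Lemma crossmC u v : crossm G v u = - crossm G u v.
Proof. by rewrite /crossm vectC mulNmx scalerN. Qed.

Lemma crossmDr u v w : crossm G u (v + w) = crossm G u v + crossm G u w.
Proof. by rewrite /crossm vectDr mulmxDl scalerDr. Qed.

Lemma crossmZr u v a : crossm G u (a *: v) = a *: crossm G u v.
Proof. by rewrite /crossm vectZr -scalemxAl !scalerA mulrC. Qed.

Lemma crossmNr u v : crossm G u (- v) = - crossm G u v.
Proof. by rewrite -scaleN1r crossmZr scaleN1r. Qed.

Lemma crossmDl u v w : crossm G (v + w) u = crossm G v u + crossm G w u.
Proof. by rewrite crossmC crossmDr opprD (crossmC u v) (crossmC u w). Qed.

Lemma crossmZl u v a : crossm G (a *: v) u = a *: crossm G v u.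
Proof. by rewrite crossmC crossmZr (crossmC u v) scalerN. Qed.

Lemma crossmNl u v : crossm G (- u) v = - crossm G u v.
Proof. by rewrite -scaleN1r crossmZl scaleN1r. Qed.

Lemma crossmm u : crossm G u u = 0.
Proof.
rewrite /crossm (_ : vect u u = 0) ?mul0mx ?scaler0 //.
by apply/rowP; apply: forall_ord3; rewrite !vectE mxE; ring.
Qed.

(* Raising indices after the product, or lowering them before it: in the second
   form the Euclidean triple product identity gives [crossm_crossm]. *)
Lemma vect_invmx u v :
  crossm G u v = (Num.sqrt (\det G))^-1 *: vect (u *m G) (v *m G).
Proof.
apply: (can_inj (mulmxK uG)); rewrite crossmG -scalemxAl -{5}GT vect_mulmx.
by rewrite scalerA -{3}(sqr_sqrtr (ltW detG)) expr2 mulKf.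
Qed.

Lemma crossm_crossm u v w :
  crossm G u (crossm G v w) = dotm G u w *: v - dotm G u v *: w.
Proof.
rewrite (vect_invmx v w) crossmZr /crossm scalerA mulVf // scale1r vect_vect.
rewrite !trmx_mul GT !mulmxA mulmxBl -!scalemxAl !mulmxK //.
Qed.

Lemma dotm_crossmC u v w : dotm G (crossm G u v) w = - dotm G v (crossm G u w).
Proof.
rewrite (dotmC v) // !dotm_crossm -mulrN; congr (_ * _).
by rewrite !det3 !rows3E; ring.
Qed.

Lemma dotm_crossm_cycle u v w :
  dotm G (crossm G u v) w = dotm G (crossm G v w) u.
Proof. by rewrite !dotm_crossm; congr (_ * _); rewrite !det3 !rows3E; ring. Qed.

End Cross.

(** The volume factor contributes the square root of (det J)^2, which equals det J because det J is
    positive: here the orientation of the atlas makes the cross product independent of the chart. *)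
Lemma crossm_congr J G u v : 0 < \det J -> 0 < \det G ->
  crossm (J *m G *m J^T) u v *m J = crossm G (u *m J) (v *m J).
Proof.
move=> dJ dG; have uJ : J \in unitmx by rewrite unitmxE unitfE gt_eqF.
have uG : G \in unitmx by rewrite unitmxE unitfE gt_eqF.
apply: (can_inj (mulmxK uG)); apply: (can_inj (mulmxK (_ : J^T \in unitmx))).
  by rewrite unitmx_tr.
rewrite (crossmG dG) -!mulmxA (mulmxA J) (crossmG (G := J *m G *m J^T)); last first.
  by rewrite !det_mulmx det_tr !mulr_gt0.
rewrite -scalemxAl vect_mulmx scalerA !det_mulmx det_tr mulrAC -expr2.
by rewrite sqrtrM ?sqr_ge0 // sqrtr_sqr gtr0_norm // mulrC.
Qed.

End Metric3.

Lemma mulmx_dotm_row (R : realType) (G A : 'M[R]_3) (w : 'rV[R]_3) k :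
  (w *m (G *m A^T)) 0 k = dotm G w (row k A).
Proof. by rewrite mulmxA /dotm tr_row colE mulmxA -colE [RHS]mxE. Qed.

Lemma mulmx_dotm (R : realType) (G A : 'M[R]_3) k l :
  (A *m G *m A^T) k l = dotm G (row k A) (row l A).
Proof.
by rewrite /dotm tr_row colE mulmxA -!row_mul -colE [RHS]mxE [RHS]mxE.
Qed.

(** * A unit vector in an oriented Euclidean 3-space *)

Section UnitVector.
Context {R : realType}.
Variables (G : 'M[R]_3) (xi : 'rV[R]_3).
Hypotheses (GT : G^T = G) (detG : 0 < \det G) (xi1 : dotm G xi xi = 1).
Implicit Types (u v w : 'rV[R]_3) (N : 'M[R]_3) (a b : R).

Let uG : G \in unitmx.
Proof. by rewrite unitmxE unitfE gt_eqF. Qed.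

Lemma dotm_crossm_l u v : dotm G (crossm G u v) u = 0.
Proof. by rewrite dotm_crossm_cycle // dotm_crossm_cycle // crossmm // dotm0l. Qed.

Lemma dotm_crossm_r u v : dotm G (crossm G u v) v = 0.
Proof. by rewrite dotm_crossm_cycle // crossmm // dotm0l. Qed.

(** The almost contact identity phi^2 = - 1 + eta xi. *)
Lemma crossm_xi2 v : crossm G xi (crossm G xi v) = dotm G xi v *: xi - v.
Proof. by rewrite crossm_crossm // xi1 scale1r. Qed.

(** By [crossm_xi2] a vector w equals <xi, w> xi - xi x (xi x w). For w = u x v the triple product
    gives xi x w = <xi, v> u - <xi, u> v. *)
Lemma crossm_split u v : crossm G u v =
  dotm G (crossm G xi u) v *: xi - dotm G xi v *: crossm G xi u
  + dotm G xi u *: crossm G xi v.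
Proof.
have hx : dotm G xi (crossm G u v) = dotm G (crossm G xi u) v.
  by rewrite dotmC // -dotm_crossm_cycle.
have := crossm_xi2 (crossm G u v); rewrite hx (crossm_crossm GT detG xi u v).
rewrite crossmDr crossmNr !crossmZr => E.
rewrite -[LHS](subKr (dotm G (crossm G xi u) v *: xi)) -E opprB.
by rewrite addrA addrAC.
Qed.

(* The form taken by A = nabla xi in the geodesic shear-free case, with twist [a]
   and expansion [b]. *)
Definition rotation_form N a b := forall v,
  v *m N = - a *: crossm G xi v + b *: (v - dotm G xi v *: xi).

(** The trans-Sasakian equation in a single tangent space, with (A u) x v in place of (nabla_u phi)
    v. The multiple of xi subtracted in [rotation_form] cancels the last term of [crossm_split]. *)
Lemma crossm_rotation_form N a b u v : rotation_form N a b ->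
  crossm G (u *m N) v =
    a *: (dotm G u v *: xi - dotm G xi v *: u)
    + b *: (dotm G (crossm G xi u) v *: xi - dotm G xi v *: crossm G xi u).
Proof.
move=> ->; rewrite crossmDl 2!crossmZl crossmDl crossmNl crossmZl.
rewrite (crossm_split u v) addrK (crossmC G v (crossm G xi u)).
rewrite (crossm_crossm GT detG v xi u) scaleNr -scalerN opprK.
by rewrite (dotmC v u GT) (dotmC v xi GT).
Qed.

(** The product with xi loses the component along xi; orthogonality of [v *m N] to xi restores it,
    so a second product with xi recovers [N]. *)
Lemma rotation_form_of_cross N a b : (forall v, dotm G (v *m N) xi = 0) ->
  (forall v, - crossm G xi (v *m N) =
     a *: (dotm G xi v *: xi - v) - b *: crossm G xi v) ->
  rotation_form N a b.
Proof.
move=> Nxi H v; have := congr1 (fun w => - crossm G xi (- w)) (H v).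
rewrite opprK crossm_xi2 dotmC // Nxi scale0r sub0r opprK => ->.
rewrite crossmNr opprK crossmDr crossmZr crossmDr crossmZr crossmm scaler0 add0r.
rewrite !crossmNr crossmZr crossm_xi2 scalerN scaleNr; congr (_ + _).
by rewrite -scalerN opprB.
Qed.

Section Frame.
Variables e0 e1 : 'rV[R]_3.
Hypotheses (e00 : dotm G e0 e0 = 1) (e11 : dotm G e1 e1 = 1)
  (e01 : dotm G e0 e1 = 0) (e0x : dotm G e0 xi = 0) (e1x : dotm G e1 xi = 0).

Let E := rows3 e0 e1 xi.

Let EGE : E *m G *m E^T = 1%:M.
Proof.
have rowE : forall k, row k E = [:: e0; e1; xi]`_k.
  by move=> k; apply/rowP => j; rewrite !mxE.
apply/matrixP; apply: forall_ord3; apply: forall_ord3; rewrite mulmx_dotm !rowE !mxE /=;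
  rewrite ?(dotmC xi e0 GT) ?(dotmC xi e1 GT) ?(dotmC e1 e0 GT);
  by rewrite ?(e00, e01, e11, e0x, e1x, xi1).
Qed.

Lemma frame_expansion w :
  w = dotm G w e0 *: e0 + dotm G w e1 *: e1 + dotm G w xi *: xi.
Proof.
(* [EGE] makes [G *m E^T] a right inverse of the square matrix [E], hence also a left inverse. The
   coordinates of [w] in the frame are then the entries of [w *m (G *m E^T)], which are inner
   products. *)
have GEE : G *m E^T *m E = 1%:M by apply: mulmx1C; rewrite mulmxA.
have EE (c : 'rV[R]_3) : c *m E = c 0 ord0 *: e0 + c 0 (lift ord0 ord0) *: e1
    + c 0 (lift ord0 (lift ord0 ord0)) *: xi.
  apply/rowP => j; rewrite mulrow3 !rows3E.
  by rewrite !mxE.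
rewrite -[LHS]mulmx1 -GEE mulmxA EE.
rewrite !mulmx_dotm_row.
by congr (_ *: _ + _ *: _ + _ *: _); congr (dotm G w _); apply/rowP => j;
  rewrite mxE rows3E.
Qed.

Hypothesis E_gt0 : 0 < \det E.

Lemma frame_cross : crossm G xi e0 = e1 /\ crossm G xi e1 = - e0.
Proof.
(* The determinant of [EGE] shows that this number has square 1; the orientation of the frame makes
   it positive. *)
have V1 : Num.sqrt (\det G) * \det E = 1.
  apply: (@pexpIrn _ 2) => //; rewrite ?nnegrE ?ler01 ?mulr_ge0 ?sqrtr_ge0 ?(ltW E_gt0) //.
  rewrite exprMn sqr_sqrtr ?(ltW detG) // expr1n.
  have := congr1 determinant EGE; rewrite !det_mulmx det_tr det1 => <-; ring.
have H : crossm G xi e0 = e1.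
  rewrite [LHS]frame_expansion dotm_crossm_r dotm_crossm_l !scale0r add0r addr0.
  rewrite dotm_crossm // (_ : \det (rows3 xi e0 e1) = \det E) ?V1 ?scale1r //.
  by rewrite !det3 !rows3E; ring.
split=> //; by rewrite -H crossm_xi2 (dotmC xi e0 GT) e0x scale0r sub0r.
Qed.

(** The coefficients are read off the image of [e0]: as xi x e0 = e1, the form demands e0 N = b e0 -
    a e1. The two conditions on the entries then force the right image of [e1]. *)
Lemma rotation_form_of_frame N :
  xi *m N = 0 -> (forall v, dotm G (v *m N) xi = 0) ->
  dotm G (e0 *m N) e0 = dotm G (e1 *m N) e1 ->
  dotm G (e0 *m N) e1 + dotm G (e1 *m N) e0 = 0 ->
  rotation_form N (- dotm G (e0 *m N) e1) (dotm G (e0 *m N) e0).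
Proof.
move=> xiN Nxi f00 f01 v; have [c0 c1] := frame_cross.
rewrite opprK (dotmC xi v GT) [in LHS](frame_expansion v).
rewrite [X in crossm G xi X](frame_expansion v) [X in X - _](frame_expansion v).
rewrite addrK !crossmDr !crossmZr crossmm scaler0 addr0 c0 c1.
rewrite !mulmxDl -!scalemxAl xiN scaler0 addr0.
rewrite [in LHS](frame_expansion (e0 *m N)) [in LHS](frame_expansion (e1 *m N)).
rewrite !Nxi !scale0r !addr0 -f00 -(addr0_eq f01).
set x := dotm G v e0; set y := dotm G v e1; set p := dotm G _ e1; set q := dotm G _ e0.
apply/rowP => j; rewrite !mxE; ring.
Qed.

Lemma frame_entries N a b : rotation_form N a b ->
  [/\ dotm G (e0 *m N) e0 = b, dotm G (e1 *m N) e1 = b,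
      dotm G (e0 *m N) e1 = - a & dotm G (e1 *m N) e0 = a].
Proof.
move=> H; have [c0 c1] := frame_cross.
rewrite !H c0 c1 (dotmC xi e0 GT) (dotmC xi e1 GT) e0x e1x !scale0r !subr0.
rewrite !dotmE (dotmC e1 e0 GT) e00 e01 e11; split; ring.
Qed.

End Frame.

Lemma frame_complete e0 : dotm G e0 e0 = 1 -> dotm G e0 xi = 0 ->
  let e1 := crossm G xi e0 in
  [/\ dotm G e1 e1 = 1, dotm G e0 e1 = 0, dotm G e1 xi = 0 &
      0 < \det (rows3 e0 e1 xi)].
Proof.
move=> e00 e0x e1.
have e11 : dotm G e1 e1 = 1.
  rewrite {1}/e1 dotm_crossmC // crossm_xi2 (dotmC xi e0 GT) e0x scale0r sub0r.
  by rewrite dotmNr opprK.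
split=> //; first by rewrite dotmC // dotm_crossm_r.
  exact: dotm_crossm_l.
(* The volume of (xi, e0, e1) is <xi x e0, e1> = <e1, e1> = 1, and a cyclic permutation preserves
   the determinant. *)
have := @ltr01 R; rewrite -e11 {1}/e1 dotm_crossm // pmulr_rgt0 ?sqrtr_gt0 //.
rewrite (_ : \det (rows3 xi e0 e1) = \det (rows3 e0 e1 xi)) //.
by rewrite !det3 !rows3E; ring.
Qed.

Definition cross_mx : 'M[R]_3 := \matrix_k crossm G xi (delta_mx 0 k).

Lemma mul_cross_mx v : v *m cross_mx = crossm G xi v.
Proof.
rewrite mulmx_sum_row [in RHS](row_sum_delta v).
rewrite (big_morph _ (crossmDr G xi) (_ : crossm G xi 0 = 0)); last first.
  by have := crossmZr G xi 0 0; rewrite !scale0r.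
by apply: eq_bigr => k _; rewrite rowK crossmZr.
Qed.

(** With the indices lowered before the product ([vect_invmx]), the trace contracts the alternating
    symbol with the symmetric matrix [G]. *)
Lemma tr_cross_mx : \tr cross_mx = 0.
Proof.
have D k j : ((delta_mx 0 k : 'rV[R]_3) *m G) 0 j = G k j by rewrite -rowE mxE.
have Gs k l : G k l = G l k by rewrite -{1}GT mxE.
have C k : cross_mx k k =
    (Num.sqrt (\det G))^-1 * vect (xi *m G) (delta_mx 0 k *m G) 0 k.
  by rewrite mxE vect_invmx // mxE.
rewrite /mxtrace sum3 !C !vectE !D (Gs o1 o0) (Gs o2 o0) (Gs o2 o1).
ring.
Qed.

Lemma rotation_form_trace N a b : rotation_form N a b ->
  2^-1 * \tr N = b /\ 2^-1 * \tr (N *m cross_mx) = a.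
Proof.
(* [P] is the orthogonal projection onto xi. Writing C for [cross_mx], one has N = - a C + b (1 -
   P), tr P = 1, tr C = 0, C^2 = P - 1 and P C = 0, so that tr N = 2 b and tr (N C) = - a (1 - 3) =
   2 a. *)
move=> H; pose P := G *m xi^T *m xi.
have vP v : v *m P = dotm G xi v *: xi.
  rewrite /P 2!mulmxA [v *m G *m xi^T]mx11_scalar mul_scalar_mx dotmC //.
have mxeq (A B : 'M[R]_3) : (forall v : 'rV[R]_3, v *m A = v *m B) -> A = B.
  by move=> AB; apply/row_matrixP => k; rewrite !rowE.
have NE : N = - a *: cross_mx + b *: (1%:M - P).
  apply: mxeq => v; rewrite H mulmxDr -!scalemxAr mulmxBr mulmx1 vP.
  by rewrite mul_cross_mx.
have trP : \tr P = 1.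
  by rewrite /P mxtrace_mulC mulmxA trace_mx11.
have C2 : cross_mx *m cross_mx = P - 1%:M.
  apply: mxeq => v; rewrite mulmxA !mul_cross_mx crossm_xi2 mulmxBr mulmx1 vP //.
have PC : P *m cross_mx = 0.
  apply: mxeq => v; rewrite mulmxA mul_cross_mx vP crossmZr crossmm.
  by rewrite scaler0 mulmx0.
have NC : N *m cross_mx = - a *: (P - 1%:M) + b *: cross_mx.
  by rewrite NE mulmxDl -!scalemxAl mulmxBl mul1mx PC subr0 C2.
rewrite NC NE !mxtraceD !mxtraceZ !raddfB /= trP tr_cross_mx mxtrace1.
have n2 : (2 : R) != 0 by rewrite pnatr_eq0.
by split; field.
Qed.

End UnitVector.

(** * The Levi-Civita connection in a chart *)

Section MatrixDerivatives.
Context {R : realType} {V : normedModType R}.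
Implicit Types (x v : V).

Lemma differentiable_mulmx p q r (A : V -> 'M[R]_(p, q)) (B : V -> 'M[R]_(q, r)) x :
  differentiable A x -> differentiable B x ->
  differentiable (fun y => A y *m B y) x /\
  forall v, 'D_v (fun y => A y *m B y) x = 'D_v A x *m B x + A x *m 'D_v B x.
Proof.
move=> dA dB.
have dAe k l : differentiable (fun y => A y k l : R^o) x by move/differentiable_mxP: dA.
have dBe k l : differentiable (fun y => B y k l : R^o) x by move/differentiable_mxP: dB.
have E k l : (fun y => (A y *m B y) k l : R^o) =
    \sum_m ((fun y => A y k m : R^o) * (fun y => B y m l : R^o)).
  by apply/funext => y; rewrite mxE fct_sumE.
have dAB : differentiable (fun y => A y *m B y) x.
  apply/differentiable_mxP => k l; rewrite E; apply: differentiable_sum => m.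
  exact: differentiableM.
split=> // v; apply/matrixP => k l; rewrite derive_coord // E derive_sum; last first.
  by move=> m; apply/diff_derivable/differentiableM.
rewrite !mxE -big_split /=; apply: eq_bigr => m _.
rewrite deriveM; [|exact: diff_derivable|exact: diff_derivable].
by rewrite !derive_coord // addrC /GRing.scale /= [_ * B x m l]mulrC.
Qed.

Lemma differentiable_trmx p q (A : V -> 'M[R]_(p, q)) x :
  differentiable A x ->
  differentiable (fun y => (A y)^T) x /\
  forall v, 'D_v (fun y => (A y)^T) x = ('D_v A x)^T.
Proof.
move=> dA; have E k l : (fun y => (A y)^T k l : R^o) = (fun y => A y l k).
  by apply/funext => y; rewrite mxE.
have dT : differentiable (fun y => (A y)^T) x.
  by apply/differentiable_mxP => k l; rewrite E; move/differentiable_mxP: dA.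
split=> // v; apply/matrixP => k l.
by rewrite derive_coord // E -derive_coord // mxE.
Qed.

Lemma derive_dotm (G : V -> 'M[R]_3) (Y Z : V -> 'rV[R]_3) x v :
  differentiable G x -> differentiable Y x -> differentiable Z x ->
  'D_v (fun y => dotm (G y) (Y y) (Z y) : R^o) x =
  dotm (G x) ('D_v Y x) (Z x) + dotm ('D_v G x) (Y x) (Z x)
  + dotm (G x) (Y x) ('D_v Z x).
Proof.
move=> dG dY dZ; rewrite /dotm.
have [dYG DYG] := differentiable_mulmx dY dG.
have [dZT DZT] := differentiable_trmx dZ.
have [d D] := differentiable_mulmx dYG dZT.
by rewrite -derive_coord // D DYG DZT !mulmxDl mxE [X in X + _]mxE.
Qed.

(** Jacobi's formula for a variation of the form T M + M T^T, which is the form that [Gam_metric]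
    gives to the derivative of the metric. *)
Lemma derive_det3 (M : V -> 'M[R]_3) (T : 'M[R]_3) x v :
  differentiable M x -> 'D_v M x = T *m M x + M x *m T^T ->
  'D_v (fun y => \det (M y) : R^o) x = 2 * \tr T * \det (M x).
Proof.
move=> dM DM.
pose F k l : V -> R := fun y => M y k l.
have d k l : is_derive x v (F k l) (T k o0 * M x o0 l + T k o1 * M x o1 l +
    T k o2 * M x o2 l + (M x k o0 * T l o0 + M x k o1 * T l o1 + M x k o2 * T l o2)).
  split; first exact/diff_derivable/((differentiable_mxP M x).1 dM).
  rewrite -derive_coord // DM mxE; congr (_ + _); rewrite mxE sum3 //.
  by rewrite !mxE.
rewrite (_ : (fun y => _) = F o0 o0 * (F o1 o1 * F o2 o2 - F o1 o2 * F o2 o1)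
  - F o0 o1 * (F o1 o0 * F o2 o2 - F o1 o2 * F o2 o0)
  + F o0 o2 * (F o1 o0 * F o2 o1 - F o1 o1 * F o2 o0)); last first.
  by apply/funext => y; rewrite det3.
rewrite derive_val det3 /mxtrace sum3 /GRing.scale /= !fctE /F; ring.
Qed.

Lemma derive_vect (Y Z : V -> 'rV[R]_3) x v :
  differentiable Y x -> differentiable Z x ->
  differentiable (fun y => vect (Y y) (Z y)) x /\
  'D_v (fun y => vect (Y y) (Z y)) x = vect ('D_v Y x) (Z x) + vect (Y x) ('D_v Z x).
Proof.
move=> dY dZ.
pose y k : V -> R := fun t => Y t 0 k; pose z k : V -> R := fun t => Z t 0 k.
have dy k : is_derive x v (y k) ('D_v Y x 0 k).
  split; first exact/diff_derivable/((differentiable_mxP Y x).1 dY).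
  by rewrite derive_coord.
have dz k : is_derive x v (z k) ('D_v Z x 0 k).
  split; first exact/diff_derivable/((differentiable_mxP Z x).1 dZ).
  by rewrite derive_coord.
have E : ((fun t => vect (Y t) (Z t) 0 o0 : R) = y o1 * z o2 - y o2 * z o1) *
   ((fun t => vect (Y t) (Z t) 0 o1 : R) = y o2 * z o0 - y o0 * z o2) *
   ((fun t => vect (Y t) (Z t) 0 o2 : R) = y o0 * z o1 - y o1 * z o0).
  by do !split; apply/funext => t; rewrite vectE.
have dyz k : differentiable (y k : V -> R^o) x /\ differentiable (z k : V -> R^o) x.
  split; [exact: ((differentiable_mxP Y x).1 dY)|exact: ((differentiable_mxP Z x).1 dZ)].
have dyz2 k l m n : differentiable (y k * z l - y m * z n : V -> R^o) x.
  by apply: differentiableB; apply: differentiableM;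
    case: (dyz k) (dyz l) (dyz m) (dyz n) => [? ?] [? ?] [? ?] [? ?].
have d : differentiable (fun t => vect (Y t) (Z t)) x.
  by apply/differentiable_mxP => i; rewrite (ord1 i); apply: forall_ord3; rewrite E.
split=> //; apply/rowP; apply: forall_ord3; rewrite derive_coord // E derive_val;
  by rewrite [RHS]mxE !vectE /GRing.scale /= /y /z; ring.
Qed.

Lemma derive_scale p q (s : V -> R^o) (W : V -> 'M[R]_(p, q)) x v :
  differentiable s x -> differentiable W x ->
  'D_v (fun y => s y *: W y) x = s x *: 'D_v W x + 'D_v s x *: W x.
Proof.
move=> ds dW; have dWe := (differentiable_mxP W x).1 dW.
have E k l : (fun y => (s y *: W y) k l : R^o) = s * (fun y => W y k l : R^o).
  by apply/funext => y; rewrite mxE.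
have d : differentiable (fun y => s y *: W y) x.
  by apply/differentiable_mxP => k l; rewrite E; apply: differentiableM.
apply/matrixP => k l; rewrite derive_coord // E deriveM; last 2 first.
- exact: diff_derivable.
- exact/diff_derivable/dWe.
by rewrite !mxE derive_coord // [W x k l *: _]mulrC.
Qed.

End MatrixDerivatives.

Section Charts.
Context {R : realType} {M : oriented_3manifold R}.
Implicit Types (i j : chart_index M) (p : M) (U : set M).

Lemma chart_image_open i U : open U -> open (chart i @` (U `&` chart_dom i)).
Proof.
move=> oU; rewrite openE => _ [p [Up ip] <-]; rewrite /interior.
have imp : (chart i @` chart_dom i) (chart i p) by exists p.
have N1 : nbhs (chart i p) (chart i @` chart_dom i).
  exact: open_nbhs_nbhs (conj (@chart_im_open _ _ i) imp).
have N2 : nbhs (chart i p) (chart_inv i @^-1` U).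
  apply: (chart_inv_continuous imp); rewrite chartK //.
  exact: open_nbhs_nbhs.
apply: filterS (filterI N1 N2) => _ [[q iq <-]]; rewrite /= chartK // => Uq.
by exists q.
Qed.

Lemma nbhs_chart_image i p U : open U -> U p -> chart_dom i p ->
  nbhs (chart i p) (chart i @` (U `&` chart_dom i)).
Proof.
move=> oU Up ip; apply: open_nbhs_nbhs; split; first exact: chart_image_open.
by exists p.
Qed.

End Charts.

Section Connection.
Context {R : realType} {M : oriented_3manifold R} (g : riemannian_metric M).
Implicit Types (X Y Z : tangent_field M) (i j : chart_index M) (p : M).

Lemma metric_det_gt0 i p : chart_dom i p -> 0 < \det (metric_mx g i p).
Proof.
move=> ip; apply: (posdef_det_gt0 (Defs.metric_sym g ip)).
by move=> v v0; exact: metric_pos.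
Qed.

Lemma metric_unit i p : chart_dom i p -> metric_mx g i p \in unitmx.
Proof. by move=> ip; rewrite unitmxE unitfE gt_eqF // metric_det_gt0. Qed.

Lemma metric_differentiable i p : chart_dom i p ->
  differentiable (metric_mx g i \o chart_inv i) (chart i p).
Proof.
by move=> ip; apply: (smooth_differentiable (metric_smooth g i)); exists p.
Qed.

(* The matrix of v |-> nabla_v on fields with constant components, so that
   nabla_v Y = D_v Y + Y *m Gam v. *)
Definition Gam i p (v : 'rV[R]_3) : 'M[R]_3 :=
  \matrix_(b, c) \sum_a v 0 a * christoffel g i p a b c.

Lemma nablaE X Y i p : nabla g X Y i p =
  'D_(X i p) (Y i \o chart_inv i) (chart i p) + Y i p *m Gam i p (X i p).
Proof.
rewrite /nabla; congr (_ + _); apply/rowP => c; rewrite !mxE exchange_big /=.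
apply: eq_bigr => b _; rewrite mxE mulr_sumr; apply: eq_bigr => a _.
by rewrite mulrA [X in X * _]mulrC mulrA.
Qed.

Lemma crossE X Y i p :
  cross g X Y i p = crossm (metric_mx g i p) (X i p) (Y i p).
Proof.
rewrite /cross /crossm scalemxAl; congr (_ *m _).
by apply/rowP => k; rewrite !mxE.
Qed.

Lemma phiE xi X i p :
  phi g xi X i p = crossm (metric_mx g i p) (xi i p) (X i p).
Proof.
rewrite /phi crossE /horizontal crossmDr -scaleNr crossmZr crossmm.
by rewrite scaler0 addr0.
Qed.

Lemma dmetric_sym i p a b c : chart_dom i p ->
  dmetric g i p a b c = dmetric g i p a c b.
Proof.
move=> ip; apply: near_eq_derive.
have := nbhs_chart_image openT I ip; rewrite setTI.
apply: filterS => _ [q iq <-]; rewrite chartK //.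
by rewrite -[in LHS](Defs.metric_sym g iq) mxE.
Qed.

Lemma derive_metric i p v b c : chart_dom i p ->
  ('D_v (metric_mx g i \o chart_inv i) (chart i p)) b c =
  \sum_a v 0 a * dmetric g i p a b c.
Proof.
move=> ip; have dG := metric_differentiable ip.
rewrite (derive_rowE _ dG) summxE; apply: eq_bigr => a _.
by rewrite mxE derive_coord.
Qed.

(** Lowering the index cancels [invmx] and leaves the Christoffel symbols of the first kind. *)
Lemma christoffel_lower i p a b c : chart_dom i p ->
  \sum_e christoffel g i p a b e * metric_mx g i p e c =
  2^-1 * (dmetric g i p a b c + dmetric g i p b a c - dmetric g i p c a b).
Proof.
move=> ip; set G := metric_mx g i p.
have GT : G^T = G by exact: Defs.metric_sym.
pose S d := dmetric g i p a b d + dmetric g i p b a d - dmetric g i p d a b.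
have -> : \sum_e christoffel g i p a b e * G e c =
    2^-1 * \sum_d (\sum_e G c e * invmx G e d) * S d.
  rewrite mulr_sumr.
  under [RHS]eq_bigr do rewrite mulr_suml mulr_sumr.
  rewrite exchange_big /=; apply: eq_bigr => e _.
  rewrite /christoffel mulr_sumr mulr_suml; apply: eq_bigr => d _.
  rewrite -/(S d) -/G (_ : G c e = G e c); first by ring.
  by rewrite -[in LHS]GT mxE.
have V d : \sum_e G c e * invmx G e d = (c == d)%:R.
  by have := mulmxV (metric_unit ip : G \in unitmx) => /matrixP/(_ c d); rewrite !mxE.
congr (_ * _); under eq_bigr do rewrite V.
rewrite (bigD1 c) //= eqxx mul1r big1 ?addr0 // => d dc.
by rewrite eq_sym (negbTE dc) mul0r.
Qed.

(** Vanishing of the torsion, written without indices. *)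
Lemma Gam_sym i p u v : chart_dom i p -> u *m Gam i p v = v *m Gam i p u.
Proof.
move=> ip; apply/rowP => c; rewrite !mxE.
under eq_bigr do rewrite mxE mulr_sumr.
rewrite exchange_big /=; apply: eq_bigr => a _; rewrite mxE mulr_sumr.
apply: eq_bigr => b _; rewrite mulrCA; congr (_ * (_ * _)).
rewrite /christoffel; congr (_ * _); apply: eq_bigr => d _; congr (_ * _).
by rewrite (dmetric_sym d a b ip) [X in X - _]addrC.
Qed.

(** Compatibility nabla g = 0 in coordinates. Together with [Gam_sym] it determines [Gam], by
    [torsion_free_metric_unique]. *)
Lemma Gam_metric i p v (G := metric_mx g i p) : chart_dom i p ->
  'D_v (metric_mx g i \o chart_inv i) (chart i p) =
  Gam i p v *m G + G *m (Gam i p v)^T.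
Proof.
move=> ip; have H b c : (Gam i p v *m G) b c = \sum_a v 0 a *
    (2^-1 * (dmetric g i p a b c + dmetric g i p b a c - dmetric g i p c a b)).
  rewrite mxE; under eq_bigr do rewrite mxE mulr_suml.
  rewrite exchange_big /=; apply: eq_bigr => a _.
  rewrite -christoffel_lower // mulr_sumr; apply: eq_bigr => e _.
  by rewrite -mulrA.
apply/matrixP => b c; rewrite derive_metric // mxE H.
have -> : (G *m (Gam i p v)^T) b c = (Gam i p v *m G) c b.
  have GT : G^T = G by exact: Defs.metric_sym.
  have <- : (Gam i p v *m G)^T = G *m (Gam i p v)^T by rewrite trmx_mul GT.
  by rewrite mxE.
rewrite H -big_split /=; apply: eq_bigr => a _; rewrite -mulrDr; congr (_ * _).
rewrite (dmetric_sym a c b ip).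
by field.
Qed.

Lemma bracket_nabla X Y i p : chart_dom i p ->
  bracket X Y i p = nabla g X Y i p - nabla g Y X i p.
Proof.
move=> ip; rewrite !nablaE (Gam_sym (X i p) _ ip) opprD addrACA.
by rewrite subrr addr0.
Qed.

Lemma deriv_along_dot X Y Z i p : chart_dom i p ->
  differentiable (Y i \o chart_inv i) (chart i p) ->
  differentiable (Z i \o chart_inv i) (chart i p) ->
  deriv_along X (dot g Y Z) i p =
  dot g (nabla g X Y) Z i p + dot g Y (nabla g X Z) i p.
Proof.
move=> ip dY dZ; rewrite /deriv_along.
have := derive_dotm (X i p) (metric_differentiable ip) dY dZ.
rewrite -[dot g _ _ _ _]/(dotm _ _ _) -[dot g Y _ _ _]/(dotm _ _ _) !nablaE.
rewrite /= !chartK // Gam_metric // => ->.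
set G := metric_mx g i p; set T := Gam i p _.
rewrite dotmDl dotmDr dotm_mul dotm_mulr.
have -> : dotm (T *m G + G *m T^T) (Y i p) (Z i p) =
  dotm (T *m G) (Y i p) (Z i p) + dotm (G *m T^T) (Y i p) (Z i p).
  by rewrite /dotm mulmxDr mulmxDl mxE.
by ring.
Qed.

Lemma volume_smooth i :
  smooth_on (chart i @` chart_dom i)
    (fun y => Num.sqrt (\det (metric_mx g i (chart_inv i y))) : R^o).
Proof.
have oI := @chart_im_open _ _ i.
apply: smooth_sqrt => // [_ [q iq <-]|]; first by rewrite chartK // metric_det_gt0.
apply: smooth_det => // k l.
exact: ((smooth_mxP oI _).1 (metric_smooth g i)).
Qed.

(** In coordinates, this expresses that the volume form is parallel: it is Jacobi's formula followed
    by the derivative of the square root. *)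
Lemma derive_volume i p v : chart_dom i p ->
  'D_v (fun y => Num.sqrt (\det (metric_mx g i (chart_inv i y))) : R^o) (chart i p)
  = \tr (Gam i p v) * Num.sqrt (\det (metric_mx g i p)).
Proof.
move=> ip; have dG := metric_differentiable ip.
have detG := metric_det_gt0 ip.
have dd : differentiable (fun y => \det (metric_mx g i (chart_inv i y)) : R^o) (chart i p).
  apply: (@smooth_differentiable _ _ _ (chart i @` chart_dom i)); last by exists p.
  have oI := @chart_im_open _ _ i.
  apply: smooth_det => // k l.
  exact: ((smooth_mxP oI _).1 (metric_smooth g i)).
have ds : is_derive (\det (metric_mx g i (chart_inv i (chart i p)))) 1 (@Num.sqrt R)
    (2 * Num.sqrt (\det (metric_mx g i p)))^-1.
  by rewrite chartK //; exact: is_derive1_sqrt.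
have [_ ->] := derive_comp1 dd ds.
have := @derive_det3 _ _ _ (Gam i p v) (chart i p) v dG.
rewrite /= chartK // -Gam_metric // => /(_ erefl) ->.
have s0 : Num.sqrt (\det (metric_mx g i p)) != 0 by rewrite gt_eqF // sqrtr_gt0.
rewrite -{2}(sqr_sqrtr (ltW detG)); by field.
Qed.

(** The inverse metric is avoided by differentiating the lowered product, equal to the volume factor
    times [vect]. The trace term from the volume and the [Gam] terms from the metric combine through
    [vect_derivation] into the [Gam] terms of the two factors. *)
Lemma nabla_cross X Y Z i p : chart_dom i p ->
  differentiable (Y i \o chart_inv i) (chart i p) ->
  differentiable (Z i \o chart_inv i) (chart i p) ->
  differentiable (cross g Y Z i \o chart_inv i) (chart i p) ->
  nabla g X (cross g Y Z) i p =
  crossm (metric_mx g i p) (nabla g X Y i p) (Z i p) +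
  crossm (metric_mx g i p) (Y i p) (nabla g X Z i p).
Proof.
move=> ip dY dZ dC; have dG := metric_differentiable ip.
have uG := metric_unit ip; have detG := metric_det_gt0 ip.
rewrite !nablaE crossmDl crossmDr; set v := X i p; set T := Gam i p v.
set x := chart i p; set G := metric_mx g i p.
have [_ DCG] := differentiable_mulmx dC dG.
have E : 'D_v (fun y => (cross g Y Z i \o chart_inv i) y *m
     (metric_mx g i \o chart_inv i) y) x =
   Num.sqrt (\det G) *: ('D_v (fun y => vect ((Y i \o chart_inv i) y)
     ((Z i \o chart_inv i) y)) x + \tr T *: vect (Y i p) (Z i p)).
  rewrite (@near_eq_derive _ _ _ _ (fun y =>
     Num.sqrt (\det (metric_mx g i (chart_inv i y))) *:
      vect ((Y i \o chart_inv i) y) ((Z i \o chart_inv i) y))); last first.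
    have := nbhs_chart_image openT I ip; rewrite setTI.
    apply: filterS => _ [q iq <-]; rewrite /= chartK // crossE.
    by rewrite crossmG // metric_det_gt0.
  have [dW _] := derive_vect v dY dZ.
  have ds : differentiable (fun y => Num.sqrt (\det (metric_mx g i (chart_inv i y))) : R^o) x.
    by apply: (smooth_differentiable (volume_smooth i)); exists p.
  rewrite derive_scale // derive_volume //= chartK // -/T.
  by rewrite scalerDr scalerA [_ * \tr T]mulrC.
apply: (can_inj (mulmxK uG)); rewrite -/G.
have [_ DV] := derive_vect v dY dZ.
have := DCG v; rewrite E DV Gam_metric // -/G -/T /= !chartK //.
rewrite crossE -/G mulmxDr mulmxA !mulmxDl !crossmG //.
have D := vect_derivation T (Y i p) (Z i p).
rewrite [_ *m (G *m _)]mulmxA crossmG // addrA => /esym/(canRL (addrK _)) ->.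
rewrite -scalemxAl -scalerBr -addrA D -!scalerDr; congr (_ *: _).
by rewrite addrACA.
Qed.

End Connection.

(** * Change of charts *)

(** Alternating the two symmetries three times each restores the order of the arguments, with the
    sign (-1)^3. *)
Lemma braid (R : realType) (V : Type) (T : V -> V -> V -> R) :
  (forall u v w, T u v w = T v u w) -> (forall u v w, T u v w = - T u w v) ->
  forall u v w, T u v w = 0.
Proof.
move=> S A u v w; have : T u v w = - T u v w.
  by rewrite {1}S A S A S opprK A.
move/eqP; rewrite -addr_eq0 -mulr2n mulrn_eq0 /= => /eqP //.
Qed.

(* The difference of two connections is a tensor symmetric in its first two
   arguments and antisymmetric in its last two. *)
Lemma torsion_free_metric_unique (R : realType) (G : 'M[R]_3)
    (A B : 'rV[R]_3 -> 'M[R]_3) : G^T = G -> G \in unitmx ->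
  (forall u w, u *m A w = w *m A u) -> (forall u w, u *m B w = w *m B u) ->
  (forall w, A w *m G + G *m (A w)^T = B w *m G + G *m (B w)^T) ->
  forall w, A w = B w.
Proof.
move=> GT uG AS BS AB v; apply/eqP; rewrite -subr_eq0; apply/eqP.
pose D w := A w - B w; rewrite -/(D v).
have DS u w : u *m D w = w *m D u by rewrite /D 2!mulmxBr AS BS.
have DA w : D w *m G + G *m (D w)^T = 0.
  by rewrite /D mulmxBl linearB /= mulmxBr addrACA -opprD AB subrr.
apply/row_matrixP => k; rewrite !rowE mulmx0.
apply: (dotm_inj uG) => w; rewrite dotm0l.
apply: (@braid R _ (fun w u z => dotm G (u *m D w) z)) => [u z t|u z t].
  by rewrite DS.
rewrite dotm_mul (dotmC (t *m _) z GT) dotm_mulr.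
apply/eqP; rewrite -addr_eq0; apply/eqP.
have -> : dotm (D u *m G) z t + dotm (G *m (D u)^T) z t =
    dotm (D u *m G + G *m (D u)^T) z t.
  by rewrite /dotm mulmxDr mulmxDl [RHS]mxE.
by rewrite DA /dotm mulmx0 mul0mx mxE.
Qed.

Section Transition.
Context {R : realType} {M : oriented_3manifold R} (g : riemannian_metric M).
Implicit Types (X Y Z : tangent_field M) (U : set M).
Variables (i j : chart_index M).

Let O := chart i @` (chart_dom i `&` chart_dom j).
Let tau := chart j \o chart_inv i.
Let J (y : 'rV[R]_3) : 'M[R]_3 := 'J tau y.

Let oO : open O.
Proof. rewrite /O setIC; apply: chart_image_open; exact: chart_dom_open. Qed.

Let smooth_tau : smooth_on O tau.
Proof. exact: transition_smooth. Qed.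

Let d_tau y : O y -> differentiable tau y.
Proof. exact: smooth_differentiable. Qed.

Let J_entry y a b : O y -> J y a b = ('D_(delta_mx 0 a) tau y) 0 b.
Proof. move=> Oy; rewrite deriveEjacobian; last exact: d_tau.
by have := congr1 (fun r : 'rV_3 => r 0 b) (rowE a (J y)); rewrite mxE. Qed.

Lemma jacobian_smooth : smooth_on O J.
Proof.
apply/smooth_mxP => // a b.
apply: (@smooth_on_eq _ _ _ _ (fun y => ('D_(delta_mx 0 a) tau y) 0 b : R^o)) => //.
  by move=> y Oy; rewrite J_entry.
exact: ((smooth_mxP oO _).1 (smooth_on_derive a smooth_tau)).
Qed.

(** Both sides are the second derivative of the transition map in the directions [u] and [v]. *)
Lemma jacobian_sym y u v : O y -> u *m 'D_v J y = v *m 'D_u J y.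
Proof.
move=> Oy; have dJ := smooth_differentiable jacobian_smooth Oy.
have nO : nbhs y O by apply: open_nbhs_nbhs.
have E w a k : ('D_w J y) a k = \sum_c w 0 c *
    'D_(delta_mx 0 c) ('D_(delta_mx 0 a) (fun z => tau z 0 k : R^o)) y.
  rewrite (derive_rowE _ dJ) summxE; apply: eq_bigr => c _.
  rewrite mxE derive_coord //; congr (_ * _); apply: near_eq_derive.
  apply: filterS nO => z Oz; rewrite J_entry // derive_coord //; exact: d_tau.
have P (w : 'rV[R]_3) (A : 'M[R]_3) k : (w *m A) 0 k = \sum_a w 0 a * A a k.
  by rewrite mxE.
have C c a k : 'D_(delta_mx 0 c) ('D_(delta_mx 0 a) (fun z => tau z 0 k : R^o)) y =
    'D_(delta_mx 0 a) ('D_(delta_mx 0 c) (fun z => tau z 0 k : R^o)) y.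
  apply: (derive_comm c a oO _ Oy).
  exact: ((smooth_mxP oO _).1 smooth_tau 0 k 2).
move: (E v) (E u); move: ('D_v J y) ('D_u J y) => A B EA EB.
apply/rowP => k; rewrite !P.
under eq_bigr do rewrite EA mulr_sumr.
rewrite exchange_big /=; apply: eq_bigr => c _; rewrite EB mulr_sumr.
by apply: eq_bigr => a _; rewrite mulrCA C.
Qed.

Variable p : M.
Hypotheses (ip : chart_dom i p) (jp : chart_dom j p).
Let x := chart i p.

Let Ox : O x.
Proof. by exists p. Qed.

Let taux : tau x = chart j p.
Proof. by rewrite /tau /x /= chartK. Qed.

Let dJ : differentiable J x.
Proof. exact: smooth_differentiable jacobian_smooth Ox. Qed.

Let derive_tau v : 'D_v tau x = v *m J x.
Proof. by rewrite deriveEjacobian; [|exact: d_tau]. Qed.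

Lemma jacobian_unit : J x \in unitmx.
Proof.
by rewrite unitmxE unitfE gt_eqF // /J /x transition_oriented.
Qed.

Lemma near_transition U : open U -> U p ->
  \forall y \near x, O y /\ U (chart_inv i y).
Proof.
move=> oU Up.
have := @nbhs_chart_image _ _ i p (U `&` chart_dom j) (openI oU (chart_dom_open j)) (conj Up jp) ip.
apply: filterS => _ [q [[Uq jq] iq] <-]; rewrite chartK //; split=> //.
by exists q.
Qed.

(** Product rule for the identity Y_j o tau = Y_i J near the point. The last term, a second
    derivative of tau, keeps the derivative of components from being a tensor. *)
Lemma derive_field_transition U Y v : open U -> U p -> smooth_field_on U Y ->
  'D_(v *m J x) (Y j \o chart_inv j) (chart j p) =
  'D_v (Y i \o chart_inv i) x *m J x + Y i p *m 'D_v J x.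
Proof.
move=> oU Up [Yt Ys].
have dYi : differentiable (Y i \o chart_inv i) x.
  by apply: (smooth_differentiable (Ys i)); exists p.
have dYj : differentiable (Y j \o chart_inv j) (tau x).
  by rewrite taux; apply: (smooth_differentiable (Ys j)); exists p.
have -> : 'D_(v *m J x) (Y j \o chart_inv j) (chart j p) =
    'D_v ((Y j \o chart_inv j) \o tau) x.
  by rewrite (derive_comp v (d_tau Ox) dYj) derive_tau taux.
have [_ D] := differentiable_mulmx dYi dJ.
rewrite -[in Y i p](chartK ip) -[Y i _]/((Y i \o chart_inv i) x) -D.
apply: near_eq_derive; apply: filterS (near_transition oU Up) => y [Oy Uy].
case: (Oy) Uy => q [iq jq] <-; rewrite /= !chartK // => Uq.
rewrite (Yt i j q) // /transition_jacobian //.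
Qed.

Let metric_transition_near : \forall y \near x,
  metric_mx g i (chart_inv i y) =
  J y *m (metric_mx g j \o chart_inv j) (tau y) *m (J y)^T.
Proof.
apply: filterS (near_transition openT I) => _ [[q [iq jq] <-] _].
rewrite /= !chartK //; exact: metric_transition.
Qed.

Let derive_metric_transition v (Gj := metric_mx g j p) :
  'D_v (metric_mx g i \o chart_inv i) x =
  'D_v J x *m Gj *m (J x)^T
  + J x *m 'D_(v *m J x) (metric_mx g j \o chart_inv j) (chart j p) *m (J x)^T
  + J x *m Gj *m ('D_v J x)^T.
Proof.
rewrite (near_eq_derive _ metric_transition_near).
have dG : differentiable (metric_mx g j \o chart_inv j) (tau x).
  by rewrite taux; exact: metric_differentiable.
have dGt := differentiable_comp (d_tau Ox) dG.
have [dJG DJG] := differentiable_mulmx dJ dGt.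
have [dJT DJT] := differentiable_trmx dJ.
have [_ D] := differentiable_mulmx dJG dJT.
rewrite D DJG DJT (derive_comp v (d_tau Ox) dG) derive_tau taux.
by rewrite /= taux chartK // !mulmxDl.
Qed.

Lemma Gam_transition v :
  Gam g i p v *m J x = 'D_v J x + J x *m Gam g j p (v *m J x).
Proof.
have uJ := jacobian_unit.
pose G := metric_mx g i p; pose Gj := metric_mx g j p.
have GT : G^T = G by exact: Defs.metric_sym.
have uG : G \in unitmx by exact: metric_unit.
have GE : G = J x *m Gj *m (J x)^T by exact: metric_transition.
(* [L w *m invmx (J x)] is the connection of chart [j] pulled back to chart [i]. It is torsion-free
   by [jacobian_sym] and [Gam_sym], and metric by differentiating G = J Gj J^T, so it must be
   [Gam g i p]. *)
pose L w := 'D_w J x + J x *m Gam g j p (w *m J x).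
have LG w : L w *m invmx (J x) *m G = L w *m Gj *m (J x)^T.
  by rewrite GE !mulmxA mulmxKV.
have LS u w : u *m L w = w *m L u.
  rewrite /L 2!mulmxDr (jacobian_sym u w Ox) 2!mulmxA.
  by rewrite (Gam_sym g (u *m J x) (w *m J x) jp).
suff -> : Gam g i p v = L v *m invmx (J x) by rewrite mulmxKV.
apply: (@torsion_free_metric_unique R G (Gam g i p) (fun w => L w *m invmx (J x))) => //.
- by move=> u w; exact: Gam_sym.
- by move=> u w; rewrite 2!mulmxA LS.
move=> w; rewrite -Gam_metric // derive_metric_transition Gam_metric // -/Gj LG.
have -> : G *m (L w *m invmx (J x))^T = J x *m Gj *m (L w)^T.
  have GjT : Gj^T = Gj by exact: Defs.metric_sym.
  by rewrite -{1}GT -trmx_mul LG !trmx_mul trmxK GjT mulmxA.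
rewrite /L; move: ('D_w J x) (Gam g j p (w *m J x)) => A B.
have -> : (A + J x *m B)^T = A^T + B^T *m (J x)^T by rewrite linearD /= trmx_mul.
rewrite !(mulmxDl, mulmxDr) !mulmxA -!addrA; congr (_ + (_ + _)).
by rewrite addrC.
Qed.

Lemma dot_transition X Y : X j p = X i p *m J x -> Y j p = Y i p *m J x ->
  dot g X Y j p = dot g X Y i p.
Proof.
move=> Xp Yp; rewrite -[LHS]/(dotm _ _ _) Xp Yp -dotm_congr.
by rewrite -(metric_transition g ip jp).
Qed.

Lemma crossm_transition u v : crossm (metric_mx g i p) u v *m J x =
  crossm (metric_mx g j p) (u *m J x) (v *m J x).
Proof.
rewrite (metric_transition g ip jp) crossm_congr //.
  exact: transition_oriented.
exact: metric_det_gt0.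
Qed.

End Transition.

(** * Smooth fields built from the metric, and the tensor nabla Y *)

Section FieldCalculus.
Context {R : realType} {M : oriented_3manifold R} (g : riemannian_metric M).
Implicit Types (X Y Z : tangent_field M) (i j : chart_index M) (p : M) (U : set M).

Lemma chart_imageK i U y : (chart i @` (U `&` chart_dom i)) y ->
  chart i (chart_inv i y) = y.
Proof. by move=> [q [_ iq] <-]; rewrite chartK. Qed.

Lemma chart_image_inv i U y : (chart i @` (U `&` chart_dom i)) y ->
  U (chart_inv i y) /\ chart_dom i (chart_inv i y).
Proof. by move=> [q [Uq iq] <-]; rewrite chartK. Qed.

Definition smooth_scalar_on U (f : scalar_field M) : Prop :=
  (forall i j p, U p -> chart_dom i p -> chart_dom j p -> f j p = f i p) /\
  (forall i, @smooth_on R R^o 3 (chart i @` (U `&` chart_dom i)) (f i \o chart_inv i)).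

Lemma smooth_field_restrict U V X : U `<=` V -> smooth_field_on V X -> smooth_field_on U X.
Proof.
move=> UV [Xt Xs]; split=> [i j p /UV|i]; first exact: Xt.
by apply: smooth_on_sub (Xs i) => _ [q [/UV Uq iq] <-]; exists q.
Qed.

Lemma field_differentiable U X i p : smooth_field_on U X -> U p -> chart_dom i p ->
  differentiable (X i \o chart_inv i) (chart i p).
Proof. by move=> [_ Xs] Up ip; apply: (smooth_differentiable (Xs i)); exists p. Qed.

Lemma metric_smooth_on U i : open U ->
  smooth_on (chart i @` (U `&` chart_dom i)) (metric_mx g i \o chart_inv i).
Proof.
by move=> oU; apply: smooth_on_sub (metric_smooth g i) => _ [q [_ iq] <-]; exists q.
Qed.

Lemma smooth_scalar_dot U X Y : open U -> smooth_field_on U X ->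
  smooth_field_on U Y -> smooth_scalar_on U (dot g X Y).
Proof.
move=> oU [Xt Xs] [Yt Ys]; split=> [i j p Up ip jp|i].
  by apply: dot_transition => //; [exact: Xt|exact: Yt].
have oI := chart_image_open (i := i) oU.
have XG := smooth_mulmx oI (Xs i) (metric_smooth_on i oU).
have YT : smooth_on (chart i @` (U `&` chart_dom i)) (fun y => (Y i (chart_inv i y))^T).
  apply/smooth_mxP => // k l.
  rewrite (_ : (fun y => _) = fun y => Y i (chart_inv i y) l k).
    exact: ((smooth_mxP oI _).1 (Ys i)).
  by apply/funext => y; rewrite mxE.
exact: ((smooth_mxP oI _).1 (smooth_mulmx oI XG YT)).
Qed.

Lemma smooth_field_scale U (f : scalar_field M) X : open U ->
  smooth_scalar_on U f -> smooth_field_on U X ->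
  smooth_field_on U (fun i p => f i p *: X i p).
Proof.
move=> oU [ft fs] [Xt Xs]; split=> [i j p Up ip jp|i].
  by rewrite (ft i j p) // (Xt i j p) // scalemxAl.
have oI := chart_image_open (i := i) oU.
apply/smooth_mxP => // k l.
rewrite (_ : (fun y => _) = fun y => f i (chart_inv i y) * X i (chart_inv i y) k l).
  exact: (smoothM oI (fs i) ((smooth_mxP oI _).1 (Xs i) k l)).
by apply/funext => y; rewrite /= mxE.
Qed.

Lemma smooth_fieldB U X Y : open U ->
  smooth_field_on U X -> smooth_field_on U Y ->
  smooth_field_on U (fun i p => X i p - Y i p).
Proof.
move=> oU [Xt Xs] [Yt Ys]; split=> [i j p Up ip jp|i].
  by rewrite (Xt i j p) // (Yt i j p) // mulmxBl.
have oI := chart_image_open (i := i) oU.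
apply/smooth_mxP => // k l.
rewrite (_ : (fun y => _) = fun y => X i (chart_inv i y) k l - Y i (chart_inv i y) k l).
  exact: (smoothB oI ((smooth_mxP oI _).1 (Xs i) k l) ((smooth_mxP oI _).1 (Ys i) k l)).
by apply/funext => y; rewrite /= !mxE.
Qed.

Lemma smooth_field_horizontal U xi X : open U -> smooth_field_on U xi ->
  smooth_field_on U X -> smooth_field_on U (horizontal g xi X).
Proof.
move=> oU xis Xs; apply: smooth_fieldB => //.
by apply: smooth_field_scale => //; exact: smooth_scalar_dot.
Qed.

Lemma smooth_crossm (W : set 'rV[R]_3) i (u v : 'rV[R]_3 -> 'rV[R]_3) : open W ->
  W `<=` chart i @` chart_dom i -> smooth_on W u -> smooth_on W v ->
  smooth_on W (fun y => crossm (metric_mx g i (chart_inv i y)) (u y) (v y)).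
Proof.
move=> oW WU us vs.
have vects : smooth_on W (fun y => vect (u y) (v y)).
  have [ue ve] := ((smooth_mxP oW _).1 us, (smooth_mxP oW _).1 vs).
  apply/smooth_mxP => // k l; rewrite (ord1 k).
  have S a b c d : smooth_on W (fun y => u y 0 a * v y 0 b - u y 0 c * v y 0 d : R^o).
    exact: (smoothB oW (smoothM oW (ue 0 a) (ve 0 b)) (smoothM oW (ue 0 c) (ve 0 d))).
  move: l; apply: forall_ord3; apply: (smooth_on_eq oW _ (S _ _ _ _)) => y _;
    by rewrite vectE.
have invs : smooth_on W (fun y => invmx (metric_mx g i (chart_inv i y))).
  apply: smooth_invmx => //; last exact: smooth_on_sub (metric_smooth g i).
  by move=> y /WU [q iq <-]; rewrite chartK // metric_unit.
have VI := (smooth_mxP oW _).1 (smooth_mulmx oW vects invs).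
apply/smooth_mxP => // k l.
have vols := smooth_on_sub WU (volume_smooth g i).
apply: (smooth_on_eq oW _ (smoothM oW vols (VI k l))) => y _.
by rewrite /crossm [in RHS]mxE.
Qed.

Lemma smooth_field_cross U X Y : open U ->
  smooth_field_on U X -> smooth_field_on U Y -> smooth_field_on U (cross g X Y).
Proof.
move=> oU [Xt Xs] [Yt Ys]; split=> [i j p Up ip jp|i].
  by rewrite !crossE (crossm_transition g ip jp) (Xt i j p) // (Yt i j p).
have oI := chart_image_open (i := i) oU.
rewrite (_ : cross g X Y i \o chart_inv i = fun y =>
    crossm (metric_mx g i (chart_inv i y)) (X i (chart_inv i y)) (Y i (chart_inv i y))).
  apply: smooth_crossm (Xs i) (Ys i) => //.
  by move=> _ [q [_ iq] <-]; exists q.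
by apply/funext => y; rewrite /= crossE.
Qed.

Lemma smooth_christoffel i a b c :
  smooth_on (chart i @` chart_dom i)
    (fun y => christoffel g i (chart_inv i y) a b c : R^o).
Proof.
have oI := @chart_im_open _ _ i.
have Gs := metric_smooth g i; have Ge := (smooth_mxP oI _).1 Gs.
have ds k l m : smooth_on (chart i @` chart_dom i)
    (fun y => dmetric g i (chart_inv i y) k l m : R^o).
  apply: (smooth_on_eq oI _ (smooth_on_derive k (Ge l m))) => _ [q iq <-].
  by rewrite /dmetric chartK.
have Gi : smooth_on (chart i @` chart_dom i) (fun y => invmx (metric_mx g i (chart_inv i y))).
  by apply: smooth_invmx => // _ [q iq <-]; rewrite chartK // metric_unit.
apply: smoothM => //; first exact: smooth_cst.
apply: smooth_sum => // d; apply: smoothM => //; first exact: ((smooth_mxP oI _).1 Gi).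
by apply: smoothB => //; apply: smoothD.
Qed.

Lemma GamD i p u v : Gam g i p (u + v) = Gam g i p u + Gam g i p v.
Proof.
apply/matrixP => b c; rewrite !mxE -big_split /=; apply: eq_bigr => a _.
by rewrite mxE mulrDl.
Qed.

Lemma GamZ i p k v : Gam g i p (k *: v) = k *: Gam g i p v.
Proof.
apply/matrixP => b c; rewrite !mxE mulr_sumr; apply: eq_bigr => a _.
by rewrite mxE mulrA.
Qed.

(* The endomorphism v |-> nabla_v Y, acting on row vectors. *)
Definition nabla_op Y i p : 'M[R]_3 := \matrix_k
  ('D_(delta_mx 0 k) (Y i \o chart_inv i) (chart i p) + Y i p *m Gam g i p (delta_mx 0 k)).

Lemma mul_nabla_op Y i p v : differentiable (Y i \o chart_inv i) (chart i p) ->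
  v *m nabla_op Y i p = 'D_v (Y i \o chart_inv i) (chart i p) + Y i p *m Gam g i p v.
Proof.
move=> dY; have -> : Gam g i p v = \sum_k v 0 k *: Gam g i p (delta_mx 0 k).
  rewrite {1}(row_sum_delta v) (big_morph _ (GamD i p) (_ : Gam g i p 0 = 0)).
    by apply: eq_bigr => k _; rewrite GamZ.
  by have := GamZ i p 0 0; rewrite !scale0r.
rewrite (derive_rowE _ dY) mulmx_sum_row mulmx_sumr -big_split /=.
by apply: eq_bigr => k _; rewrite rowK scalerDr scalemxAr.
Qed.

Lemma nabla_opE X Y i p : differentiable (Y i \o chart_inv i) (chart i p) ->
  nabla g X Y i p = X i p *m nabla_op Y i p.
Proof. by move=> dY; rewrite nablaE mul_nabla_op. Qed.

(** The inhomogeneous term Y 'D J arises on one side from differentiating the components of [Y] and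
    on the other from [Gam_transition]; the two occurrences coincide, so [nabla_op] is a tensor. *)
Lemma nabla_op_transition U Y i j p : open U -> U p -> smooth_field_on U Y ->
  chart_dom i p -> chart_dom j p ->
  nabla_op Y i p *m transition_jacobian i j p =
  transition_jacobian i j p *m nabla_op Y j p.
Proof.
move=> oU Up Ys ip jp; apply/row_matrixP => k; rewrite !rowE !mulmxA.
rewrite !mul_nabla_op; [|exact: field_differentiable Ys _ _..].
rewrite (derive_field_transition ip jp _ oU Up Ys) mulmxDl -addrA; congr (_ + _).
have -> : Y j p = Y i p *m transition_jacobian i j p by case: Ys => + _; exact.
by rewrite -!mulmxA (Gam_transition g ip jp) mulmxDr.
Qed.

Lemma smooth_nabla_op U Y i : open U -> smooth_field_on U Y ->
  smooth_on (chart i @` (U `&` chart_dom i)) (nabla_op Y i \o chart_inv i).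
Proof.
move=> oU Ys; have oI := chart_image_open (i := i) oU; have Ysi := Ys.2 i.
have Yse := (smooth_mxP oI _).1 Ysi.
apply/smooth_mxP => // k l.
apply: (@smooth_on_eq _ _ _ _ (fun y =>
  'D_(delta_mx 0 k) (fun z => (Y i \o chart_inv i) z 0 l : R^o) y +
   \sum_b Y i (chart_inv i y) 0 b *
     christoffel g i (chart_inv i y) k b l)) => //.
  move=> y Wy; rewrite /= mxE mxE (chart_imageK Wy) derive_coord; last first.
    exact: smooth_differentiable Ysi Wy.
  congr (_ + _); rewrite mxE; apply: eq_bigr => b _; congr (_ * _).
  rewrite mxE (bigD1 k) //= big1 ?addr0 ?mxE ?eqxx ?mul1r // => a ak.
  by rewrite mxE (negbTE ak) andbF mul0r.
apply: smoothD => //; first exact: smooth_on_derive.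
apply: smooth_sum => // b; apply: smoothM => //.
by apply: smooth_on_sub (smooth_christoffel i k b l) => _ [q [_ iq] <-]; exists q.
Qed.

End FieldCalculus.

(** * Extension of tangent vectors to global fields *)

Section Extension.
Context {R : realType} {M : oriented_3manifold R}.
Implicit Types (i j k : chart_index M) (p : M).

Lemma transition_tau_differentiable i j p : chart_dom i p -> chart_dom j p ->
  differentiable (chart j \o chart_inv i) (chart i p).
Proof.
by move=> ip jp; apply: (smooth_differentiable (transition_smooth i j)); exists p.
Qed.

Lemma derive_transition i j p v : chart_dom i p -> chart_dom j p ->
  'D_v (chart j \o chart_inv i) (chart i p) = v *m transition_jacobian i j p.
Proof.
by move=> ip jp; rewrite deriveEjacobian //; exact: transition_tau_differentiable.
Qed.

Lemma transition_jacobian_cocycle i j k p :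
  chart_dom i p -> chart_dom j p -> chart_dom k p ->
  transition_jacobian i k p = transition_jacobian i j p *m transition_jacobian j k p.
Proof.
move=> ip jp kp; apply/row_matrixP => a; rewrite !rowE mulmxA.
set v := delta_mx 0 a.
apply: (etrans (esym (derive_transition v ip kp))).
apply: (etrans _ (derive_transition _ jp kp)); rewrite -(derive_transition v ip jp).
have E : (chart j \o chart_inv i) (chart i p) = chart j p by rewrite /= chartK.
have dj := transition_tau_differentiable ip jp.
have dk : differentiable (chart k \o chart_inv j) ((chart j \o chart_inv i) (chart i p)).
  by rewrite E; exact: transition_tau_differentiable.
have := derive_comp v dj dk; rewrite [in RHS]E => <-.
apply: near_eq_derive.
apply: filterS (nbhs_chart_image (chart_dom_open j) jp ip) => _ [q [jq iq] <-].
by rewrite /= !chartK.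
Qed.

Lemma transition_jacobian_id i p : chart_dom i p -> transition_jacobian i i p = 1%:M.
Proof.
move=> ip; apply/row_matrixP => a; rewrite !rowE mulmx1 -(derive_transition _ ip ip).
rewrite (@near_eq_derive _ _ _ _ id) ?derive_id //.
have := nbhs_chart_image openT I ip.
by apply: filterS => y /chart_imageK.
Qed.

Lemma flat_gt0 t : 0 < t -> 0 < @flat R 0 t.
Proof. by move=> t0; rewrite /flat t0 expr0 mul1r expR_gt0. Qed.

(** The squared Euclidean distance is used because the norm of ['rV[R]_3] is the maximum norm, which
    is not smooth. *)
Definition bump (x : 'rV[R]_3) (r : R) (y : 'rV[R]_3) : R :=
  flat 0 (r ^+ 2 - \sum_k (y 0 k - x 0 k) * (y 0 k - x 0 k)).

Lemma bump_gt0 x r : 0 < r -> 0 < bump x r x.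
Proof.
move=> r0; apply: flat_gt0; rewrite big1 ?subr0 ?exprn_gt0 // => k _.
by rewrite subrr mul0r.
Qed.

Lemma bump_smooth x r : smooth_on setT (bump x r : 'rV[R]_3 -> R^o).
Proof.
have oT : open (setT : set 'rV[R]_3) by exact: openT.
have coord (k : 'I_3) : smooth_on setT (fun y : 'rV[R]_3 => y 0 k - x 0 k : R^o).
  apply: smoothB => //; last exact: smooth_cst.
  have idS : smooth_on setT (id : 'rV[R]_3 -> 'rV[R]_3).
    case=> [|m]; first by move=> y _; exact: cvg_id.
    apply: (Ck_onS_intro (F := fun a _ => delta_mx 0 a)) => //.
      by move=> a y _; rewrite derive_id.
    by move=> a; exact: Ck_on_cst.
  exact: ((smooth_mxP oT _).1 idS).
move=> m; apply: Ck_on_flat => //; move: m.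
apply: (smoothB oT); first exact: smooth_cst.
by apply: smooth_sum => // k; apply: smoothM.
Qed.

Lemma bump_support x r y (k : 'I_3) : 0 < r -> bump x r y != 0 -> `|y 0 k - x 0 k| <= r.
Proof.
move=> r0; rewrite /bump /flat; case: ifPn => [H _|]; last by rewrite eqxx.
rewrite -ler_sqr ?nnegrE ?(ltW r0) // real_normK ?num_real //.
move: H; rewrite subr_gt0 => /ltW; apply: le_trans.
rewrite (bigD1 k) //= expr2 lerDl sumr_ge0 // => l _.
by rewrite -expr2 sqr_ge0.
Qed.

(** In chart [i] the field has constant components [v], up to a cut-off normalised to equal 1 at
    [p]. *)
Definition extend_vector i p (v : 'rV[R]_3) (r : R) : tangent_field M := fun j q =>
  if `[< chart_dom i q >] then
    (bump (chart i p) r (chart i q) / bump (chart i p) r (chart i p))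
      *: (v *m transition_jacobian i j q)
  else 0.

Lemma smooth_jacobian_inv i j : smooth_on (chart j @` (chart_dom i `&` chart_dom j))
  (fun y => transition_jacobian i j (chart_inv j y)).
Proof.
have oI := chart_image_open (i := j) (chart_dom_open i).
apply/smooth_mxP => // a b.
have tauS : smooth_on (chart j @` (chart_dom i `&` chart_dom j)) (chart i \o chart_inv j).
  by rewrite setIC; exact: transition_smooth.
have oI' : open (chart i @` (chart_dom i `&` chart_dom j)).
  by rewrite setIC; apply: chart_image_open; exact: chart_dom_open.
have JS := (smooth_mxP oI' _).1 (@jacobian_smooth _ _ i j) a b.
apply: (smooth_on_eq oI _ (smooth_comp oI _ tauS JS)) => //.
by move=> _ [q [iq jq] <-]; exists q => //=; rewrite chartK.
Qed.

(** Smoothness is clear over the domain of chart [i]; the issue is at points outside it, where the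
    support might accumulate. The support lies in the image [C] of a compact cube, and [C] is closed
    because [M] is Hausdorff, so the field vanishes on an open neighbourhood of each such point. *)
Lemma exists_vector_field i p v : chart_dom i p ->
  exists2 X : tangent_field M, vector_field X & X i p = v.
Proof.
move=> ip.
have Np : nbhs (chart i p) (chart i @` chart_dom i).
  by apply: open_nbhs_nbhs; split; [exact: chart_im_open|exists p].
have /nbhs_ballP[r /= r0 Hr] := Np.
(* Half the radius leaves room for a closed cube, which contains the support of the bump, inside the
   open ball covered by the chart. *)
have r2 : 0 < r / 2 by rewrite divr_gt0.
pose x := chart i p.
pose I3 (k : 'I_3) := `[x 0 k - r / 2, x 0 k + r / 2]%classic.
pose K : set 'rV[R]_3 := [set y | forall k : 'I_3, I3 k (y ord0 k)].
have KE y : K y <-> forall k : 'I_3, `|y 0 k - x 0 k| <= r / 2.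
  by split=> H k; have := H k; rewrite /K /I3 /= in_itv /= ler_distl.
have Kc : compact K.
  by apply: (@rV_compact _ _ I3) => k; exact: segment_compact.
have KD : K `<=` chart i @` chart_dom i.
  move=> y /KE Ky; apply: Hr; rewrite -ball_normE /=.
  rewrite /Num.Def.normr/= mx_normrE (bigmax_lt _ r0) //= => -[a b] _.
  rewrite !mxE /= (ord1 a) distrC; apply: le_lt_trans (Ky b) _.
  by rewrite ltr_pdivrMr // ltr_pMr // ltr1n.
pose C := chart_inv i @` K.
have Cc : closed C.
  apply: compact_closed; first exact: manifold_hausdorff.
  apply: continuous_compact Kc; apply: continuous_in_subspaceT => y /set_mem /KD.
  exact: chart_inv_continuous.
have CD : C `<=` chart_dom i by move=> _ [y /KD[q iq <-] <-]; rewrite chartK.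
have b0 : bump x (r / 2) x != 0 by rewrite gt_eqF // bump_gt0.
exists (extend_vector i p v (r / 2)); last first.
  rewrite /extend_vector; case: asboolP => // _.
  by rewrite divff // scale1r transition_jacobian_id // mulmx1.
split=> [j k q _ jq kq|j].
  rewrite /extend_vector; case: asboolP => iq; last by rewrite mul0mx.
  by rewrite -scalemxAl -mulmxA -(transition_jacobian_cocycle iq jq kq).
rewrite setTI; apply: smooth_on_local => _ [q jq <-].
have [iq|niq] := pselect (chart_dom i q).
  exists (chart j @` (chart_dom i `&` chart_dom j)); first by exists q.
  have oI := chart_image_open (i := j) (chart_dom_open i).
  apply: (@smooth_on_eq _ _ _ _ (fun y =>
     (bump x (r / 2) ((chart i \o chart_inv j) y) / bump x (r / 2) x)
      *: (v *m transition_jacobian i j (chart_inv j y)))) => //.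
    move=> _ [q' [iq' jq'] <-]; rewrite /extend_vector /= chartK //.
    by case: asboolP.
  have tauS : smooth_on (chart j @` (chart_dom i `&` chart_dom j)) (chart i \o chart_inv j).
    by rewrite setIC; exact: transition_smooth.
  have bS : smooth_on (chart j @` (chart_dom i `&` chart_dom j))
      (fun y => bump x (r / 2) ((chart i \o chart_inv j) y) / bump x (r / 2) x : R^o).
    apply: smoothM => //; last exact: smooth_cst.
    exact: (smooth_comp oI _ tauS (@bump_smooth x (r / 2))).
  have VS := (smooth_mxP oI _).1
    (smooth_mulmx oI (@smooth_cst _ _ _ oI _ v) (@smooth_jacobian_inv i j)).
  apply/smooth_mxP => // a b; apply: (smooth_on_eq oI _ (smoothM oI bS (VS a b))) => y _.
  by rewrite [RHS]mxE.
(* Outside the domain of chart [i] the point avoids [C]. On the open complement of [C] the field is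
   zero, since a nonzero bump would place the point in [C]. *)
exists (chart j @` (~` C `&` chart_dom j)).
  by exists q => //; split=> // /CD.
have oI := chart_image_open (i := j) (closed_openC Cc).
apply: (@smooth_on_eq _ _ _ _ (fun=> 0)) => //; last exact: smooth_cst.
move=> _ [q' [nC jq'] <-]; rewrite /extend_vector /= chartK //.
case: asboolP => // iq'; rewrite (_ : bump _ _ _ = 0) ?mul0r ?scale0r //.
apply/eqP; apply: contra_notT nC => nb; exists (chart i q'); last by rewrite chartK.
by apply/KE => k; exact: bump_support nb.
Qed.

End Extension.

(** * The derivative of a unit field *)

Section UnitField.
Context {R : realType} {M : oriented_3manifold R} (g : riemannian_metric M).
Variable xi : tangent_field M.
Hypotheses (xi_smooth : vector_field xi) (xi_unit : unit_field g xi).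
Implicit Types (X Y Z : tangent_field M) (i j : chart_index M) (p : M) (U : set M).

Local Notation G i p := (metric_mx g i p).
Local Notation N i p := (nabla_op g xi i p).
Local Notation Phi i p := (cross_mx (metric_mx g i p) (xi i p)).

Let dotE X Y i p : dot g X Y i p = dotm (G i p) (X i p) (Y i p).
Proof. by []. Qed.

Let GT i p : chart_dom i p -> (G i p)^T = G i p.
Proof. exact: Defs.metric_sym. Qed.

Let detG i p : chart_dom i p -> 0 < \det (G i p).
Proof. exact: metric_det_gt0. Qed.

Let dxi i p : chart_dom i p -> differentiable (xi i \o chart_inv i) (chart i p).
Proof. by move=> ip; exact: (field_differentiable xi_smooth I ip). Qed.

Let xi1 i p : chart_dom i p -> dotm (G i p) (xi i p) (xi i p) = 1.
Proof. exact: xi_unit. Qed.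

Lemma nabla_xiE X i p : chart_dom i p -> nabla g X xi i p = X i p *m N i p.
Proof. by move=> ip; rewrite nabla_opE //; exact: dxi. Qed.

Lemma nabla_xi_perp i p v : chart_dom i p -> dotm (G i p) (v *m N i p) (xi i p) = 0.
Proof.
(* Constant components suffice for the direction: only the value at [p] in chart [i] enters the
   product rule. *)
move=> ip; pose X : tangent_field M := fun _ _ => v.
have := @deriv_along_dot _ _ g X xi xi i p ip (dxi ip) (dxi ip).
have -> : deriv_along X (dot g xi xi) i p = 0.
  rewrite /deriv_along (@near_eq_derive _ _ _ _ (cst (1 : R^o))) ?derive_cst //.
  have := nbhs_chart_image openT I ip; apply: filterS => y Wy.
  by have [_ ?] := chart_image_inv Wy; rewrite /= xi_unit.
have -> : dot g xi (nabla g X xi) i p = dot g (nabla g X xi) xi i p.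
  by apply: dotmC; exact: GT.
rewrite dotE nabla_xiE // -mulr2n => /esym/eqP; rewrite mulrn_eq0 /=.
by move=> /eqP.
Qed.

(** One chart chosen at each point turns traces into functions on [M]; [xi_betaE] and [xi_alphaE]
    show that the choice is immaterial. *)
Definition cover_chart p : chart_index M := sval (cid (chart_cover p)).

Lemma cover_chartP p : chart_dom (cover_chart p) p.
Proof. exact: (svalP (cid (chart_cover p))). Qed.

(* Under the expected form A = b (1 - eta xi) - a phi one has tr A = 2 b and
   tr (phi A) = 2 a; unlike the coefficients in a frame, these traces are global
   and visibly smooth. *)
Definition xi_beta p : R := 2^-1 * \tr (N (cover_chart p) p).
Definition xi_alpha p : R :=
  2^-1 * \tr (N (cover_chart p) p *m Phi (cover_chart p) p).

Lemma cross_mx_transition i j p : chart_dom i p -> chart_dom j p ->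
  Phi i p *m transition_jacobian i j p = transition_jacobian i j p *m Phi j p.
Proof.
move=> ip jp; apply/row_matrixP => k; rewrite !rowE !mulmxA !mul_cross_mx.
have [/(_ i j p I ip jp) xij _] := xi_smooth.
by have := crossm_transition g ip jp (xi i p) (delta_mx 0 k); rewrite -xij.
Qed.

Let nabla_op_trans i j p : chart_dom i p -> chart_dom j p ->
  N i p *m transition_jacobian i j p = transition_jacobian i j p *m N j p.
Proof. by move=> ip jp; exact: (nabla_op_transition g openT I xi_smooth ip jp). Qed.

Let transition_unit i j p : chart_dom i p -> chart_dom j p ->
  transition_jacobian i j p \in unitmx.
Proof. by move=> ip jp; exact: jacobian_unit. Qed.

Lemma xi_betaE i p : chart_dom i p -> xi_beta p = 2^-1 * \tr (N i p).
Proof.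
move=> ip; have jp := cover_chartP p.
exact: (congr1 ( *%R 2^-1) (mxtrace_similar (transition_unit jp ip) (nabla_op_trans jp ip))).
Qed.

Lemma xi_alphaE i p : chart_dom i p -> xi_alpha p = 2^-1 * \tr (N i p *m Phi i p).
Proof.
move=> ip; have jp := cover_chartP p.
have E := intertwine_mul (nabla_op_trans jp ip) (cross_mx_transition jp ip).
exact: (congr1 ( *%R 2^-1) (mxtrace_similar (transition_unit jp ip) E)).
Qed.

(** Coefficients found at a point, in any chart or frame, are the global traces. Hence local
    solutions agree and depend smoothly on the point. *)
Lemma rotation_form_coeffs i p a b : chart_dom i p ->
  rotation_form (G i p) (xi i p) (N i p) a b -> a = xi_alpha p /\ b = xi_beta p.
Proof.
move=> ip /(rotation_form_trace (GT ip) (detG ip) (xi1 ip)) [Eb Ea].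
by rewrite (xi_betaE ip) (xi_alphaE ip) Eb Ea.
Qed.

Let smooth_N i : smooth_on (chart i @` chart_dom i) (nabla_op g xi i \o chart_inv i).
Proof. by have := smooth_nabla_op g i openT xi_smooth; rewrite setTI. Qed.

Let smooth_Phi i : smooth_on (chart i @` chart_dom i) (fun y => Phi i (chart_inv i y)).
Proof.
have oI := @chart_im_open _ _ i.
have xs : smooth_on (chart i @` chart_dom i) (xi i \o chart_inv i).
  by have := xi_smooth.2 i; rewrite setTI.
apply/smooth_mxP => // k l.
have := smooth_crossm g oI (@subset_refl _ (chart i @` chart_dom i)) xs
  (@smooth_cst _ _ _ oI _ (delta_mx 0 k)).
move=> /(smooth_mxP oI) /(_ 0 l); apply: smooth_on_eq => // y _.
by rewrite [RHS]mxE.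
Qed.

Let smooth_trace i (A : 'rV[R]_3 -> 'M[R]_3) (f : M -> R) :
  smooth_on (chart i @` chart_dom i) A ->
  (forall p, chart_dom i p -> f p = 2^-1 * \tr (A (chart i p))) ->
  smooth_on (chart i @` chart_dom i) (f \o chart_inv i : _ -> R^o).
Proof.
move=> As fA; have oI := @chart_im_open _ _ i; have Ae := (smooth_mxP oI _).1 As.
apply: (@smooth_on_eq _ _ _ _ (fun y => 2^-1 * \sum_k A y k k : R^o)) => //.
  by move=> _ [p ip <-]; rewrite /= chartK // fA.
by apply: smoothM => //; [exact: smooth_cst|exact: smooth_sum].
Qed.

Lemma xi_beta_smooth : smooth_fun xi_beta.
Proof.
move=> i; apply: (smooth_trace (smooth_N i)) => p ip.
by rewrite (xi_betaE ip) /= chartK.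
Qed.

Lemma xi_alpha_smooth : smooth_fun xi_alpha.
Proof.
move=> i; have oI := @chart_im_open _ _ i.
apply: (smooth_trace (smooth_mulmx oI (smooth_N i) (smooth_Phi i))) => p ip.
by rewrite (xi_alphaE ip) /= chartK.
Qed.

Lemma lie_metric_nabla X Y i p : vector_field X -> vector_field Y -> chart_dom i p ->
  lie_metric g xi X Y i p =
  dotm (G i p) (X i p *m N i p) (Y i p) + dotm (G i p) (X i p) (Y i p *m N i p).
Proof.
move=> Xs Ys ip; rewrite /lie_metric deriv_along_dot //; last 2 first.
- exact: field_differentiable Xs I ip.
- exact: field_differentiable Ys I ip.
rewrite !dotE !(bracket_nabla g _ _ ip) !nabla_xiE //.
rewrite !dotmE; ring.
Qed.

End UnitField.

Lemma ord2P (P : 'I_2 -> Prop) : P 0 -> P 1 -> forall a, P a.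
Proof.
move=> P0 P1 a; case: (unliftP 0 a) => [b ->|-> //].
by rewrite (_ : lift 0 b = 1) //; apply/val_inj; rewrite /= (ord1 b).
Qed.

(** * Comparison of the three conditions *)

Section Equivalences.
Context {R : realType} {M : oriented_3manifold R} (g : riemannian_metric M).
Variable xi : tangent_field M.
Hypotheses (xi_smooth : vector_field xi) (xi_unit : unit_field g xi).
Implicit Types (X Y Z : tangent_field M) (i j : chart_index M) (p : M) (U : set M).

Local Notation G i p := (metric_mx g i p).
Local Notation N i p := (nabla_op g xi i p).

Let dotE X Y i p : dot g X Y i p = dotm (G i p) (X i p) (Y i p).
Proof. by []. Qed.

Let GT i p : chart_dom i p -> (G i p)^T = G i p.
Proof. exact: Defs.metric_sym. Qed.

Let detG i p : chart_dom i p -> 0 < \det (G i p).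
Proof. exact: metric_det_gt0. Qed.

Let xi1 i p : chart_dom i p -> dotm (G i p) (xi i p) (xi i p) = 1.
Proof. exact: xi_unit. Qed.

Let dxi i p : chart_dom i p -> differentiable (xi i \o chart_inv i) (chart i p).
Proof. by move=> ip; exact: (field_differentiable xi_smooth I ip). Qed.

Lemma nabla_mxE (e : 'I_2 -> tangent_field M) i p a b : chart_dom i p ->
  nabla_mx g xi e i p a b = dotm (G i p) (e a i p *m N i p) (e b i p).
Proof. by move=> ip; rewrite mxE dotE nabla_xiE. Qed.

Lemma horizontal_perp X i p : chart_dom i p ->
  dotm (G i p) (horizontal g xi X i p) (xi i p) = 0.
Proof.
move=> ip; rewrite /horizontal /eta -scaleNr dotmDl dotmZl xi1 // mulr1 dotE.
by rewrite (dotmC _ _ (GT ip)) subrr.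
Qed.

Lemma horizontal_id X i p : chart_dom i p ->
  dotm (G i p) (X i p) (xi i p) = 0 -> horizontal g xi X i p = X i p.
Proof.
move=> ip H; rewrite /horizontal /eta dotE (dotmC _ _ (GT ip)) H.
by rewrite scale0r subr0.
Qed.

(** Otherwise two coordinate vectors would both be multiples of xi, which is impossible. *)
Lemma exists_horizontal_vector i p : chart_dom i p ->
  exists v, v != dotm (G i p) (xi i p) v *: xi i p.
Proof.
move=> ip; apply: contrapT => H.
have E v : v = dotm (G i p) (xi i p) v *: xi i p.
  by apply/eqP; apply: contra_notT H => vn; exists v.
pose a := dotm (G i p) (xi i p) (delta_mx 0 0).
pose b := dotm (G i p) (xi i p) (delta_mx 0 1).
have E0 k : (delta_mx 0 0 : 'rV[R]_3) 0 k = a * xi i p 0 k by rewrite {1}(E (delta_mx 0 0)) mxE.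
have E1 k : (delta_mx 0 1 : 'rV[R]_3) 0 k = b * xi i p 0 k by rewrite {1}(E (delta_mx 0 1)) mxE.
have := E0 0; rewrite mxE /= => a0.
have := E1 0; rewrite mxE /= => b0.
have := E1 1; rewrite mxE /= => b1.
have := esym b0 => /eqP; rewrite mulf_eq0 => /orP[/eqP z|/eqP z].
  by move: b1; rewrite z mul0r => /eqP; rewrite oner_eq0.
by move: a0; rewrite z mulr0 => /eqP; rewrite oner_eq0.
Qed.

Lemma positive_open (f : scalar_field M) : smooth_scalar_on setT f ->
  open [set q | exists2 j, chart_dom j q & 0 < f j q].
Proof.
move=> [_ fs]; rewrite openE => q [j jq f0]; rewrite /interior.
have imq : (chart j @` (setT `&` chart_dom j)) (chart j q) by exists q.
have fc : {for chart j q, continuous (f j \o chart_inv j : _ -> R^o)}.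
  exact: (fs j 0 _ imq).
have f0' : 0 < (f j \o chart_inv j) (chart j q) by rewrite /= chartK.
have N1 : \forall y \near chart j q, 0 < (f j \o chart_inv j) y.
  exact: (fc _ (lt_nbhsr f0')).
have N2 : nbhs q (chart j @^-1` [set y | 0 < (f j \o chart_inv j) y]).
  exact: (chart_continuous jq N1).
have N3 : nbhs q (chart_dom j).
  by apply: open_nbhs_nbhs; split => //; exact: chart_dom_open.
apply: filterS (filterI N2 N3) => z [/= + jz]; rewrite chartK // => fz.
by exists j.
Qed.

(** A vector with nonzero horizontal part at [p] is extended to a field; normalising its horizontal
    part [h] where it does not vanish gives the first vector, and the cross product with xi the
    second. *)
Lemma exists_frame i p : chart_dom i p ->
  exists U e, oriented_frame g xi U e /\ U p.
Proof.
move=> ip; have [v vn] := exists_horizontal_vector ip.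
have [X Xs Xp] := exists_vector_field v ip.
have oT : open (setT : set M) by exact: openT.
pose h := horizontal g xi X.
have hs : vector_field h by exact: smooth_field_horizontal.
have n2s : smooth_scalar_on setT (dot g h h) by exact: smooth_scalar_dot.
(* The set where [h] does not vanish. Asking for some chart amounts to asking for all of them,
   because the squared length is independent of the chart. *)
pose U := [set q | exists2 j, chart_dom j q & 0 < dot g h h j q].
have oU : open U by exact: positive_open.
have UE j q : U q -> chart_dom j q -> 0 < dot g h h j q.
  by move=> [k kq +] jq; rewrite (n2s.1 k j q).
have UT : U `<=` setT by [].
pose f : scalar_field M := fun j q => (Num.sqrt (dot g h h j q))^-1.
have fs : smooth_scalar_on U f.
  split=> [j k q Uq jq kq|j]; first by rewrite /f (n2s.1 j k q).
  have oI := chart_image_open (i := j) oU.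
  have n2j : smooth_on (chart j @` (U `&` chart_dom j)) (dot g h h j \o chart_inv j : _ -> R^o).
    by apply: smooth_on_sub (n2s.2 j) => _ [q [_ jq] <-]; exists q.
  have pos y : (chart j @` (U `&` chart_dom j)) y -> 0 < (dot g h h j \o chart_inv j) y.
    by move=> /chart_image_inv [? ?]; exact: UE.
  apply: (smoothV oI _ (smooth_sqrt oI pos n2j)) => y /pos ?.
  by rewrite gt_eqF // sqrtr_gt0.
pose e0 : tangent_field M := fun j q => f j q *: h j q.
have e0s : smooth_field_on U e0.
  apply: smooth_field_scale => //; exact: smooth_field_restrict hs.
pose e1 := cross g xi e0.
have e1s : smooth_field_on U e1.
  by apply: smooth_field_cross => //; exact: smooth_field_restrict xi_smooth.
exists U, (fun a => if a == 0 then e0 else e1); split; last first.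
  exists i => //.
  have h0 : h i p != 0 by rewrite /h /horizontal /eta dotE Xp subr_eq0.
  rewrite dotE; exact: metric_pos.
split=> //; first by apply: ord2P.
move=> j q Uq jq; have n0 := UE j q Uq jq; rewrite dotE in n0.
have e00 : dotm (G j q) (e0 j q) (e0 j q) = 1.
  rewrite dotmZl dotmZr /f dotE -{3}(sqr_sqrtr (ltW n0)).
  have s0 : Num.sqrt (dotm (G j q) (h j q) (h j q)) != 0 by rewrite gt_eqF // sqrtr_gt0.
  by field.
have e0x : dotm (G j q) (e0 j q) (xi j q) = 0.
  by rewrite dotmZl horizontal_perp // mulr0.
have [e11 e01 e1x pos] := frame_complete (GT jq) (detG jq) (xi1 jq) e00 e0x.
have e1E : e1 j q = crossm (G j q) (xi j q) (e0 j q) by rewrite /e1 crossE.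
split.
- apply: ord2P; apply: ord2P; rewrite /= dotE ?e1E //.
  by rewrite (dotmC _ _ (GT jq)).
- by apply: ord2P; rewrite /= dotE ?e1E.
- by rewrite /= e1E.
Qed.

(** The pivot of the equivalences. Fixing the coefficients as the global traces makes them smooth
    and independent of the frame from the outset. *)
Definition pointwise_rotation : Prop := forall i p, chart_dom i p ->
  rotation_form (G i p) (xi i p) (N i p) (xi_alpha g xi p) (xi_beta g xi p).

Lemma shear_eq0 (e : 'I_2 -> tangent_field M) i p :
  shear g xi e i p = 0 <->
  nabla_mx g xi e i p 0 0 = nabla_mx g xi e i p 1 1 /\
  nabla_mx g xi e i p 0 1 + nabla_mx g xi e i p 1 0 = 0.
Proof.
rewrite /shear /expansion; move: (nabla_mx g xi e i p) => A.
have E a b : (2^-1 *: (A + A^T) - (2^-1 * \tr A)%:M) a b =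
    2^-1 * (A a b + A b a) - 2^-1 * (A 0 0 + A 1 1) *+ (a == b).
  have -> : \tr A = A 0 0 + A 1 1.
    rewrite /mxtrace big_ord_recl big_ord1; congr (_ + A _ _); exact/val_inj.
  by rewrite !mxE.
split=> [S|[A01 A10]].
  have := E 0 0; have := E 0 1; rewrite S !mxE /= mulr1n mulr0n => E1 E0.
  by split; lra.
apply/matrixP; apply: ord2P; apply: ord2P; rewrite E [RHS]mxE /= ?mulr1n ?mulr0n; lra.
Qed.

Lemma rotation_geodesic : pointwise_rotation -> geodesic g xi.
Proof.
move=> H i p ip; rewrite nabla_xiE // H // xi1 // scale1r subrr scaler0 addr0.
by rewrite crossmm scaler0.
Qed.

Let frame_hyps U e i p : oriented_frame g xi U e -> U p -> chart_dom i p ->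
  [/\ [/\ dotm (G i p) (e 0 i p) (e 0 i p) = 1, dotm (G i p) (e 1 i p) (e 1 i p) = 1 &
      dotm (G i p) (e 0 i p) (e 1 i p) = 0],
      dotm (G i p) (e 0 i p) (xi i p) = 0, dotm (G i p) (e 1 i p) (xi i p) = 0 &
      0 < \det (rows3 (e 0 i p) (e 1 i p) (xi i p))].
Proof.
move=> [_ _ H] Up ip; have [ee ex d] := H i p Up ip.
exact: (And4 (And3 (ee 0 0) (ee 1 1) (ee 0 1)) (ex 0) (ex 1) d).
Qed.

Lemma rotation_frame U e i p a b : oriented_frame g xi U e -> U p -> chart_dom i p ->
  rotation_form (G i p) (xi i p) (N i p) a b ->
  [/\ nabla_mx g xi e i p 0 0 = b, nabla_mx g xi e i p 1 1 = b,
      nabla_mx g xi e i p 0 1 = - a & nabla_mx g xi e i p 1 0 = a].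
Proof.
move=> fr Up ip H; have [[e00 e11 e01] e0x e1x d] := frame_hyps fr Up ip.
rewrite !(nabla_mxE _ _ _ ip).
exact: (frame_entries (GT ip) (detG ip) (xi1 ip) e00 e11 e01 e0x e1x d H).
Qed.

Lemma rotation_shear_free : pointwise_rotation -> shear_free g xi.
Proof.
move=> H U e fr i p Up ip; apply/shear_eq0.
have [-> -> -> ->] := rotation_frame fr Up ip (H i p ip).
by rewrite addNr.
Qed.

Lemma geodesic_shear_free_rotation : geodesic g xi -> shear_free g xi ->
  pointwise_rotation.
Proof.
move=> geo sf i p ip; have [U [e [fr Up]]] := exists_frame ip.
have [[e00 e11 e01] e0x e1x d] := frame_hyps fr Up ip.
have := sf U e fr i p Up ip; move/shear_eq0.
rewrite !(nabla_mxE _ _ _ ip) => -[f00 f01].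
have xiN : xi i p *m N i p = 0 by rewrite -(nabla_xiE g xi_smooth xi ip) geo.
have Nxi v := nabla_xi_perp xi_smooth xi_unit v ip.
have F := rotation_form_of_frame (GT ip) (detG ip) (xi1 ip) e00 e11 e01 e0x e1x d
  xiN Nxi f00 f01.
(* The coefficients in [F] come from the chosen frame; they are recognised as the traces. *)
by have [<- <-] := rotation_form_coeffs xi_smooth xi_unit ip F.
Qed.

Lemma rotation_trans_sasakian : pointwise_rotation ->
  trans_sasakian g xi (xi_alpha g xi) (xi_beta g xi).
Proof.
move=> H X Y Xs Ys i p ip.
have oT : open (setT : set M) by exact: openT.
have -> : phi g xi Y = cross g xi Y.
  by apply/funext => j; apply/funext => q; rewrite phiE crossE.
rewrite nabla_cross //; last 3 first.
- exact: dxi.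
- exact: field_differentiable Ys I ip.
- have cs : vector_field (cross g xi Y) by exact: smooth_field_cross.
  exact: field_differentiable cs I ip.
(* By the product rule the term xi x nabla_X Y cancels phi (nabla_X Y), leaving (A X) x Y. *)
rewrite !phiE addrK nabla_xiE //.
rewrite (crossm_rotation_form (GT ip) (detG ip) (xi1 ip) _ _ (H i p ip)).
by rewrite /eta !dotE phiE.
Qed.

Lemma trans_sasakian_rotation (alpha beta : M -> R) : trans_sasakian g xi alpha beta ->
  forall i p, chart_dom i p ->
  rotation_form (G i p) (xi i p) (N i p) (alpha p) (beta p).
Proof.
move=> ts i p ip.
apply: (rotation_form_of_cross (GT ip) (detG ip) (xi1 ip)) => v.
  exact: nabla_xi_perp.
have [X Xs Xp] := exists_vector_field v ip.
have := ts X xi Xs xi_smooth i p ip.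
have -> : phi g xi xi = fun _ _ => 0.
  by apply/funext => j; apply/funext => q; rewrite phiE crossmm.
have -> : nabla g X (fun _ _ => 0) i p = 0.
  rewrite nablaE mul0mx addr0.
  rewrite (_ : (fun=> 0) \o chart_inv i = cst 0) ?derive_cst //.
rewrite sub0r phiE nabla_xiE // /eta !dotE !phiE Xp xi1 // scale1r.
rewrite (dotm_crossm_l (detG ip)) scale0r sub0r !scale1r => ->.
rewrite (dotmC _ _ (GT ip)) scalerN //.
Qed.

(** The rotation part of A is skew-adjoint and drops out of <A X, Y> + <X, A Y>, so the conformal
    factor is the expansion coefficient [xi_beta]. *)
Lemma rotation_conformal : pointwise_rotation -> conformal_foliation g xi.
Proof.
move=> H; exists (xi_beta g xi); first exact: xi_beta_smooth.
move=> X Y [Xs Xp] [Ys Yp] i p ip; rewrite lie_metric_nabla // !H //.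
have -> : dotm (G i p) (xi i p) (X i p) = 0 by exact: Xp.
have -> : dotm (G i p) (xi i p) (Y i p) = 0 by exact: Yp.
rewrite !scale0r !subr0 dotE.
have := dotm_crossmC (GT ip) (detG ip) (xi i p) (X i p) (Y i p).
move: (crossm _ _ (X i p)) (crossm _ _ (Y i p)) => c d cd.
by rewrite !dotmE cd; ring.
Qed.

Lemma section_perp_extension i p v : chart_dom i p ->
  dotm (G i p) v (xi i p) = 0 -> exists2 X, section_perp g xi X & X i p = v.
Proof.
move=> ip vx; have [X Xs Xp] := exists_vector_field v ip.
have oT : open (setT : set M) by exact: openT.
exists (horizontal g xi X); last by rewrite horizontal_id // Xp.
split; first exact: smooth_field_horizontal.
by move=> j q jq; rewrite /eta dotE (dotmC _ _ (GT jq)) horizontal_perp.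
Qed.

(** The frame vectors at [p] are extended to global sections of xi^perp. Agreement at [p] is enough
    since [lie_metric_nabla] is tensorial in both sections, and the three pairs give f00 = lambda =
    f11 and f01 + f10 = 0. *)
Lemma conformal_shear_free : conformal_foliation g xi -> shear_free g xi.
Proof.
move=> [lambda _ H] U e fr i p Up ip; apply/shear_eq0.
have [[e00 e11 e01] e0x e1x d] := frame_hyps fr Up ip.
have [X Xs X0] := section_perp_extension ip e0x.
have [Y Ys Y1] := section_perp_extension ip e1x.
have := H X X Xs Xs i p ip; have := H X Y Xs Ys i p ip; have := H Y Y Ys Ys i p ip.
rewrite !lie_metric_nabla //; try by case: Xs Ys => ? _ [? _].
rewrite !dotE X0 Y1 e00 e11 e01.
rewrite ![dotm _ (e _ i p) (_ *m _)](dotmC _ _ (GT ip)).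
rewrite !(nabla_mxE _ _ _ ip) => E11 E01 E00; split; lra.
Qed.

End Equivalences.

Unset Implicit Arguments.

Theorem proposition3p3 (R : realType) (M : oriented_3manifold R)
    (g : riemannian_metric M) (xi : tangent_field M)
    (xi_smooth : vector_field xi) (xi_unit : unit_field g xi) :
  [/\ (exists alpha beta : M -> R,
         [/\ smooth_fun alpha, smooth_fun beta &
             trans_sasakian g xi alpha beta])
      <-> (geodesic g xi /\ shear_free g xi),
      (geodesic g xi /\ shear_free g xi)
      <-> (conformal_foliation g xi /\ geodesic g xi) &
      forall alpha beta : M -> R,
        smooth_fun alpha -> smooth_fun beta ->
        trans_sasakian g xi alpha beta ->
        (forall X : tangent_field M, vector_field X ->
         forall i p, chart_dom i p ->
           nabla g X xi i p =
             - alpha p *: phi g xi X i p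
             + beta p *: (X i p - eta g xi X i p *: xi i p)) /\
        (forall (U : set M) (e : 'I_2 -> tangent_field M),
         oriented_frame g xi U e ->
         forall i p, U p -> chart_dom i p ->
           beta p = expansion g xi e i p /\ alpha p = twist g xi e i p)].
Proof.
have rot_iff : geodesic g xi /\ shear_free g xi <-> pointwise_rotation g xi.
  split=> [[geo sf]|H].
    exact: geodesic_shear_free_rotation geo sf.
  split; [exact: rotation_geodesic H|exact: rotation_shear_free H].
split.
- split=> [[alpha [beta [_ _ ts]]]|/rot_iff H].
    apply/rot_iff => i p ip.
    have F := trans_sasakian_rotation xi_smooth xi_unit ts ip.
    (* The given [alpha] and [beta] coincide at [p] with the traces used in [pointwise_rotation]. *)
    by have [<- <-] := rotation_form_coeffs xi_smooth xi_unit ip F.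
  exists (xi_alpha g xi), (xi_beta g xi); split.
  + exact: xi_alpha_smooth.
  + exact: xi_beta_smooth.
  + exact: rotation_trans_sasakian.
- split=> [[geo sf]|[cf geo]].
    by split=> //; apply: rotation_conformal => //; apply/rot_iff.
  by split=> //; exact: conformal_shear_free cf.
move=> alpha beta _ _ ts.
have F i p ip := trans_sasakian_rotation xi_smooth xi_unit ts (i := i) (p := p) ip.
split=> [X _ i p ip|U e fr i p Up ip].
  by rewrite nabla_xiE // (F i p ip) phiE.
have [f00 f11 f01 f10] := rotation_frame xi_smooth xi_unit fr Up ip (F i p ip).
rewrite /expansion /twist f10 f01 /mxtrace big_ord_recl big_ord1 f00.
rewrite (_ : lift ord0 ord0 = 1) ?f11; last exact/val_inj.
by split; field.
Qed.
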